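(* The problem \textsc{Vertex Cover above $h$-Index} is fixed-parameter tractable: there is a computable function $f$ and an algorithm that, given a graph $G$ and an integer $k$, decides whether $G$ has a vertex cover of size at most $k$ in time $f(\ell)\cdot |I|^{O(1)}$, where $\ell = k - h(G)$ and $|I|$ is the size of the input.
   Context: All graphs are finite, undirected and loopless. A vertex cover of $G$ is a set $X\subseteq V(G)$ such that every edge has at least one endpoint in $X$. The $h$-index $h(G)$ of a graph $G$ is the largest integer $k$ such that $G$ contains at least $k$ vertices each of degree at least $k$. A parameterized problem is fixed-parameter tractable (FPT) with respect to a parameter $\ell$ if it can be decided in time $f(\ell)\cdot|I|^{c}$ for a computable function $f$ and a constant $c$. *)

(* Defs.v *)
From mathcomp Require Import all_boot.
Set Implicit Arguments. Unset Strict Implicit. Unset Printing Implicit Defensive.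

(* Graphs: vertex set 'I_n, adjacency relation e (symmetric, irreflexive)  *)

Definition is_vertex_cover (n : nat) (e : rel 'I_n) (X : {set 'I_n}) : Prop :=
  forall u v, e u v -> (u \in X) \/ (v \in X).

Definition has_vc_at_most (n : nat) (e : rel 'I_n) (k : nat) : Prop :=
  exists X : {set 'I_n}, is_vertex_cover e X /\ #|X| <= k.

Definition degree (n : nat) (e : rel 'I_n) (v : 'I_n) : nat := #|[set u | e v u]|.

(* h-index: largest j such that at least j vertices have degree >= j
   (necessarily j <= n). *)
Definition hindex (n : nat) (e : rel 'I_n) : nat :=
  \max_(j < n.+1 | j <= #|[set v | j <= degree e v]|) j.

(* States 'I_(nq+3): 0 = start, 1 = accept, 2 = reject (1,2 halting).      *)
(* Tape symbols 'I_(ns+4): 0 = blank, 1 = '0', 2 = '1', 3 = '#'.           *)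

Inductive dir := DLeft | DRight | DStay.

Record TM := mkTM {
  tm_nq : nat;
  tm_ns : nat;
  tm_delta : 'I_tm_nq.+3 -> 'I_tm_ns.+4 -> 'I_tm_nq.+3 * 'I_tm_ns.+4 * dir
}.

Definition tstate (M : TM) := 'I_(tm_nq M).+3.
Definition tsym (M : TM) := 'I_(tm_ns M).+4.

(* configuration: state, left part of tape (reversed, nearest cell first),
   right part of tape starting at the head cell (missing cells are blank) *)
Definition config (M : TM) := (tstate M * seq (tsym M) * seq (tsym M))%type.

Definition blank (M : TM) : tsym M := ord0.
Definition st_start (M : TM) : tstate M := ord0.
Definition st_acc (M : TM) : tstate M := inord 1.
Definition st_rej (M : TM) : tstate M := inord 2.

Definition halting (M : TM) (q : tstate M) : bool :=
  (q == st_acc M) || (q == st_rej M).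

Definition step (M : TM) (c : config M) : config M :=
  let: (q, l, r) := c in
  if halting q then c else
  let a := head (blank M) r in
  let r' := behead r in
  let: (q', w, d) := tm_delta q a in
  match d with
  | DLeft => match l with
             | [::] => (q', [::], w :: r')
             | b :: l' => (q', l', b :: w :: r')
             end
  | DRight => (q', w :: l, r')
  | DStay => (q', l, w :: r')
  end.

Definition run (M : TM) (t : nat) (c : config M) : config M := iter t (@step M) c.

(* input alphabet 'I_3 : 0 = '0', 1 = '1', 2 = '#' *)
Definition embed (M : TM) (i : 'I_3) : tsym M := inord i.+1.

Definition init (M : TM) (w : seq 'I_3) : config M :=
  (st_start M, [::], map (@embed M) w).

Definition decides_within (M : TM) (w : seq 'I_3) (T : nat) (P : Prop) : Prop :=
  exists t, t <= T /\
    let: (q, _, _) := run t (init M w) in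
    halting q /\ (q = st_acc M <-> P).

Definition sym0 : 'I_3 := inord 0.
Definition sym1 : 'I_3 := inord 1.
Definition symH : 'I_3 := inord 2.

Definition tm_computes (M : TM) (f : nat -> nat) : Prop :=
  forall n, exists t,
    let: (q, _, r) := run t (init M (nseq n sym1)) in
    q = st_acc M /\
    exists s, r = nseq (f n) (embed M sym1) ++ s /\ all (pred1 (blank M)) s.

Definition computable (f : nat -> nat) : Prop := exists M, tm_computes M f.

(* Input encoding of an instance (G, k): adjacency matrix row by row,       *)
(* then '#', then k in binary (least significant bit first).               *)

Fixpoint binn (fuel k : nat) : seq 'I_3 :=
  match fuel with
  | 0 => [::]
  | f.+1 => if k is 0 then [::] else (if odd k then sym1 else sym0) :: binn f k./2
  end.
Definition bin (k : nat) : seq 'I_3 := binn k k.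

Definition enc_vc (n : nat) (e : rel 'I_n) (k : nat) : seq 'I_3 :=
  [seq (if e i j then sym1 else sym0) | i <- enum 'I_n, j <- enum 'I_n]
    ++ symH :: bin k.

(* Main.v *)
Require Import Defs.
From mathcomp Require Import all_boot zify.

(* Let h be the h-index of G and let Z be a vertex cover with |Z| <= k. Either
   some vertex v of degree at least h lies outside Z, and then N(v) is contained
   in Z; or Z contains all vertices of degree at least h, of which there are at
   least h. So Z contains one of n + 1 explicit sets S with |S| >= h, and the
   remaining budget k - |S| is at most k - h. For each S one enumerates the
   2^(k - |S|) guess strings; along a guess string the uncovered edges are
   scanned and one bit decides which endpoint joins the cover.

   The procedure is a while program over unary counters and bit arrays stored on
   the tracks of one tape, a counter being a single mark. Every primitive
   operation is a finite transduction of the tape from left to right, so a Turing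
   machine executes it in one sweep. All loops but the enumeration of guesses run
   at most |I| + 1 times, so a bound on the running time is read off the syntax. *)

(** A counter is a mark on a tape of |I| + 1 cells, while k is given in binary and may be
    exponential in |I|. So k is replaced by min(n, k), which preserves the answer and does not
    increase k - h, and sums are capped. A sweep compares two counters only by asking whether their
    marks share a cell; x >= j is therefore tested by counting x up to j and comparing for equality.

    The number 2^(k - h) is never computed. The guess string is a binary counter in the bits |S|,
    ..., k - 1 with bit k as overflow flag. The bit consulted when the partial cover has c elements
    is bit c, so one counter is both the size of the cover and the reading position.

    The exponential loop is not nested in another one, so its bound enters the running time only
    linearly. For n > 0 the input has length at least 2, so constant factors are absorbed by the
    exponent of |I| and f is exactly 2^l; its computability needs a machine of its own. Subtraction
    is truncated: for k < h the parameter is 0, and every candidate fails because |S| >= h > k. *)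

Set Implicit Arguments. Unset Strict Implicit. Unset Printing Implicit Defensive.

(** * Machines over arbitrary finite types *)

Section AbstractMachine.

Variables Q T : finType.
Notation state := ('I_3 + Q)%type.
Notation symb := ('I_4 + T)%type.

(** The reserved states and symbols form the left summand, so coding keeps the numbers that [TM]
    prescribes for them. *)
Definition code_state (q : state) : 'I_#|Q|.+3 :=
  match q with inl i => lshift #|Q| i | inr x => rshift 3 (enum_rank x) end.
Definition code_symb (a : symb) : 'I_#|T|.+4 :=
  match a with inl i => lshift #|T| i | inr x => rshift 4 (enum_rank x) end.
Definition decode_state (i : 'I_#|Q|.+3) : state :=
  match split (i : 'I_(3 + #|Q|)) with inl j => inl j | inr j => inr (enum_val j) end.
Definition decode_symb (i : 'I_#|T|.+4) : symb :=
  match split (i : 'I_(4 + #|T|)) with inl j => inl j | inr j => inr (enum_val j) end.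

Lemma code_stateK : cancel code_state decode_state.
Proof.
case=> [i|x]; rewrite /decode_state /=.
  by rewrite (unsplitK (inl i : 'I_3 + 'I_#|Q|)).
by rewrite (unsplitK (inr (enum_rank x) : 'I_3 + 'I_#|Q|)) enum_rankK.
Qed.

Lemma code_symbK : cancel code_symb decode_symb.
Proof.
case=> [i|x]; rewrite /decode_symb /=.
  by rewrite (unsplitK (inl i : 'I_4 + 'I_#|T|)).
by rewrite (unsplitK (inr (enum_rank x) : 'I_4 + 'I_#|T|)) enum_rankK.
Qed.

Variable delta : state -> symb -> state * symb * dir.

Definition machine : TM :=
  @mkTM #|Q| #|T| (fun q a =>
    let: (q', w, d) := delta (decode_state q) (decode_symb a) in
    (code_state q', code_symb w, d)).

Definition aconfig := (state * seq symb * seq symb)%type.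

Definition acc : state := inl (inord 1).
Definition rej : state := inl (inord 2).
Definition raw (i : nat) : symb := inl (inord i).

Definition code_config (c : aconfig) : config machine :=
  let: (q, l, r) := c in (code_state q, map code_symb l, map code_symb r).

Definition ahalting (q : state) := (q == acc) || (q == rej).

Lemma not_halting_start : ahalting (inl ord0 : state) = false.
Proof.
apply/negbTE; rewrite negb_or; apply/andP; split; apply/eqP => -[/(congr1 val)];
  by rewrite /= inordK.
Qed.

Definition astep (c : aconfig) : aconfig :=
  let: (q, l, r) := c in
  if ahalting q then c else
  let: (q', w, d) := delta q (head (raw 0) r) in
  match d with
  | DLeft => match l with
             | [::] => (q', [::], w :: behead r)
             | b :: l' => (q', l', b :: w :: behead r)
             end
  | DRight => (q', w :: l, behead r)
  | DStay => (q', l, w :: behead r)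
  end.

Lemma code_acc : code_state acc = st_acc machine.
Proof. by apply: val_inj; rewrite /= !inordK. Qed.

Lemma code_rej : code_state rej = st_rej machine.
Proof. by apply: val_inj; rewrite /= !inordK. Qed.

Lemma code_raw i : i < 4 -> code_symb (raw i) = inord i :> tsym machine.
Proof.
by move=> lt_i; apply: val_inj; rewrite /= !inordK // (leq_trans lt_i).
Qed.

Lemma code_blank : code_symb (raw 0) = blank machine.
Proof. by rewrite code_raw //; apply: val_inj; rewrite /= inordK. Qed.

Lemma step_code c : step (code_config c) = code_config (astep c).
Proof.
case: c => [[q l] r]; rewrite /step /astep /halting /ahalting /=.
rewrite -code_acc -code_rej !(can_eq code_stateK).
case: ifP => // _.
have -> : head (blank machine) (map code_symb r) = code_symb (head (raw 0) r).
  by case: r => [|a r] //; exact: esym code_blank.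
rewrite code_stateK code_symbK.
case: (delta q _) => [[q' w] d] /=.
by case: d; case: l => [|b l]; case: r => [|a r].
Qed.

Definition arun t c := iter t astep c.

Lemma run_code t c : run t (code_config c) = code_config (arun t c).
Proof. by elim: t => //= t IH; rewrite /run /= -/(run t _) IH step_code. Qed.

Lemma arunD t1 t2 c : arun (t1 + t2) c = arun t2 (arun t1 c).
Proof. by rewrite /arun addnC iterD. Qed.

Lemma arunS t c : arun t.+1 c = arun t (astep c).
Proof. exact: iterSr. Qed.

Definition ainit (w : seq 'I_3) : aconfig :=
  (inl ord0, [::], [seq raw i.+1 | i : 'I_3 <- w]).

Lemma init_code w : init machine w = code_config (ainit w).
Proof.
rewrite /init /ainit /=; congr (_, _, _); first exact: val_inj.
rewrite -map_comp; apply: eq_map => i.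
by rewrite -[RHS]/(code_symb (raw i.+1)) /embed code_raw // ltnS ltn_ord.
Qed.

Lemma decides_of_arun w t tmax (P : Prop) (b : bool) l r :
  arun t (ainit w) = (if b then acc else rej, l, r) -> t <= tmax -> (b <-> P) ->
  decides_within machine w tmax P.
Proof.
move=> run_eq le_t bP; exists t; split=> //.
rewrite init_code run_code run_eq /= /halting -code_acc -code_rej.
rewrite !(can_eq code_stateK); split; first by case: (b); rewrite eqxx ?orbT.
rewrite -bP; case: (b); split=> //.
move/(can_inj code_stateK) => [] /(congr1 val) /=; by rewrite !inordK.
Qed.

End AbstractMachine.

Arguments arun : simpl never.

(** * Sweep machines *)

(** The store is unbounded although the tape is finite: a counter whose value reaches the number of
    cells has lost its mark. Names are compared with [Nat.eqb], which simplification decides on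
    literals. *)
Record store := Store { sv : nat -> nat; sa : nat -> nat -> bool }.

Definition setv x v s :=
  Store (fun y => if Nat.eqb y x then v else sv s y) (sa s).
Definition seta a p b s :=
  Store (sv s) (fun a' p' => if Nat.eqb a' a && (p' == p) then b else sa s a' p').

Inductive op :=
  | Zero of nat
  | Copy of nat & nat
  | Inc of nat
  | Eq of nat & nat
  | Read of nat & nat
  | Write of nat & nat & bool.

Definition do_op o s : store :=
  match o with
  | Zero x => setv x 0 s
  | Copy x y => setv x (sv s y) s
  | Inc x => setv x (sv s x).+1 s
  | Write a x b => seta a (sv s x) b s
  | _ => s
  end.

(* The outcome of a test seen by a left-to-right scan that has visited the
   cells below [p]; for [Inc], the bit to be moved into cell [p]. *)
Definition scan o s p : bool :=
  match o with
  | Inc x => (sv s x).+1 == p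
  | Eq x y => (sv s x == sv s y) && (sv s x < p)
  | Read a x => sa s a (sv s x) && (sv s x < p)
  | _ => false
  end.

Section SweepMachine.

Variables nv na : nat.

(** The first bit marks the leftmost cell, where a returning head has to stop. *)
Definition cell_type : finType :=
  (bool * {ffun 'I_nv.+1 -> bool} * {ffun 'I_na.+1 -> bool})%type.

Definition cell s p : cell_type :=
  (p == 0, [ffun x : 'I_nv.+1 => sv s x == p], [ffun a : 'I_na.+1 => sa s a p]).

Definition op_ok o :=
  match o with
  | Zero x => x <= nv
  | Inc x => x <= nv
  | Copy x y => (x <= nv) && (y <= nv)
  | Eq x y => (x <= nv) && (y <= nv)
  | Read a x => (a <= na) && (x <= nv)
  | Write a x _ => (a <= na) && (x <= nv)
  end.

Definition upd m (f : {ffun 'I_m.+1 -> bool}) (x : nat) (b : bool) :=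
  [ffun y : 'I_m.+1 => if Nat.eqb y x then b else f y].

Definition transduce o (c : bool) (z : cell_type) : bool * cell_type :=
  let: (fst, vs, ars) := z in
  match o with
  | Zero x => (false, (fst, upd vs x fst, ars))
  | Copy x y => (false, (fst, upd vs x (vs (inord y)), ars))
  | Inc x => (vs (inord x), (fst, upd vs x c, ars))
  | Eq x y => (c || vs (inord x) && vs (inord y), z)
  | Read a x => (c || ars (inord a) && vs (inord x), z)
  | Write a x b => (false, (fst, vs, if vs (inord x) then upd ars a b else ars))
  end.

(** Every operation is local: the new cell is determined by the old one and one bit carried from the
    left. For [Inc] that bit is the mark just removed from the previous cell. *)
Lemma transduce_cell o s p : op_ok o ->
  transduce o (scan o s p) (cell s p) = (scan o s p.+1, cell (do_op o s) p).
Proof.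
case: o => [x|x y|x|x y|a x|a x b] /=.
- move=> lx; congr (_, (_, _, _)); apply/ffunP => z; rewrite !ffunE /=.
  by case: ifP => // _; rewrite eq_sym.
- case/andP=> lx ly; congr (_, (_, _, _)); apply/ffunP => z; rewrite !ffunE /=.
  by rewrite inordK //; case: ifP.
- move=> lx; congr (_, (_, _, _)); first by rewrite ffunE inordK ?eqSS.
  by apply/ffunP => z; rewrite !ffunE /=; case: ifP.
- case/andP=> lx ly; rewrite !ffunE !inordK //; congr (_, _); lia.
- case/andP=> lx ly; rewrite !ffunE !inordK //; congr (_, _).
  rewrite ltnS [sv s x <= p]leq_eqVlt; case: (sv s x =P p) => [->|_].
    by rewrite ltnn andbF.
  by rewrite andbF orbF.
- case/andP=> lx ly; congr (_, (_, _, _)); apply/ffunP => z; rewrite !ffunE /= inordK //.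
  rewrite [p == _]eq_sym; case: eqP => _; by rewrite ?ffunE ?andbT ?andbF ?ffunE.
Qed.

Definition instr := (op * nat * nat)%type.

Variable prog : seq instr.
Variable final : nat * nat.

(** The default, met at address [size prog], is the final comparison. Its targets [(size prog).+1]
    and [(size prog).+2] stand for acceptance and rejection, so equality of the final counters
    rejects. *)
Definition fetch pc : instr := nth (Eq final.1 final.2, (size prog).+2, (size prog).+1) prog pc.

Definition vm_step N (c : nat * store) : nat * store :=
  let: (pc, s) := c in
  let: (o, t, f) := fetch pc in
  (if scan o s N then t else f, do_op o s).

Definition instr_ok (i : instr) :=
  [&& op_ok i.1.1, i.1.2 <= (size prog).+2 & i.2 <= (size prog).+2].

Hypothesis prog_ok : all instr_ok prog.
Hypothesis final_ok : (final.1 <= nv) && (final.2 <= nv).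

Lemma fetch_ok pc : instr_ok (fetch pc).
Proof.
rewrite /fetch; case: (ltnP pc (size prog)) => [lt_pc|le_pc].
  exact: (all_nthP _ prog_ok).
by rewrite nth_default // /instr_ok /= final_ok !ltnS leqnSn leqnn.
Qed.

Definition control : finType := option ('I_(size prog).+3 * option bool)%type.
Notation state := ('I_3 + control)%type.
Notation symb := ('I_4 + cell_type)%type.

Definition scan_right pc c : state := inr (Some (inord pc, Some c)).
Definition go_left pc : state := inr (Some (inord pc, None)).
Definition loading : state := inr None.

Definition enter pc : state :=
  if pc == (size prog).+1 then acc _
  else if pc == (size prog).+2 then rej _
  else scan_right pc false.

(* Cell 0 receives the marks of all variables but 0 and 1, so they start at 0;
   variable 0 is marked at the separator and variable 1 at the extra end cell. *)
Definition load_cell (fst : bool) (i : nat) : cell_type :=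
  (fst, [ffun x : 'I_nv.+1 => if x == 0 :> nat then i == 3
                             else if x == 1 :> nat then i == 0 else fst],
   [ffun a : 'I_na.+1 => (a == 0 :> nat) && (i == 2)]).

(** A separator in the first cell means that the graph has no vertices; the machine then accepts at
    once. Otherwise loading turns the input into cells, and the blank after it into one more
    cell. *)
Definition sweep_delta (q : state) (a : symb) : state * symb * dir :=
  match q, a with
  | inl _, inl i =>
      if i == 3 :> nat then (acc _, a, DStay)
      else (loading, inr (load_cell true i), DRight)
  | inr None, inl i =>
      if i == 0 :> nat then (go_left 0, inr (load_cell false i), DLeft)
      else (loading, inr (load_cell false i), DRight)
  | inr (Some (pc, Some c)), inr z =>
      let: (c', z') := transduce (fetch pc).1.1 c z in
      (scan_right pc c', inr z', DRight)
  | inr (Some (pc, Some c)), inl _ =>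
      (go_left (if c then (fetch pc).1.2 else (fetch pc).2), a, DLeft)
  | inr (Some (pc, None)), inr z =>
      if z.1.1 then (enter pc, a, DStay) else (go_left pc, a, DLeft)
  | _, _ => (rej _, a, DStay)
  end.

Notation srun := (arun sweep_delta).

Definition cells s i m : seq symb := [seq inr (cell s p) | p <- iota i m].

Lemma cells_rev s i : rev (cells s 0 i.+1) = inr (cell s i) :: rev (cells s 0 i).
Proof. by rewrite /cells -[i.+1]addn1 iotaD map_cat rev_cat. Qed.

Lemma step_scan pc c l z r : pc <= (size prog).+2 ->
  astep sweep_delta (scan_right pc c, l, inr z :: r) =
  let: (c', z') := transduce (fetch pc).1.1 c z in
  (scan_right pc c', inr z' :: l, r).
Proof. by move=> le_pc; rewrite /= inordK //; case: transduce. Qed.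

(** The head may stand on a cell not yet written; the turn writes a blank there, whence
    [maxn m 1]. *)
Lemma step_turn pc c b l m : pc <= (size prog).+2 ->
  astep sweep_delta (scan_right pc c, b :: l, nseq m (raw _ 0)) =
  (go_left (if c then (fetch pc).1.2 else (fetch pc).2), l,
   b :: nseq (maxn m 1) (raw _ 0)).
Proof.
by move=> le_pc; case: m => [|m]; rewrite /= inordK //= maxnE subSS sub0n addn0.
Qed.

(** Left of the head the tape shows the store after the operation, from the head on still the store
    before it. *)
Lemma run_scan pc s m i r : pc <= (size prog).+2 ->
  let o := (fetch pc).1.1 in
  srun m (scan_right pc (scan o s i), rev (cells (do_op o s) 0 i), cells s i m ++ r) =
  (scan_right pc (scan o s (i + m)), rev (cells (do_op o s) 0 (i + m)), r).
Proof.
move=> le_pc o; elim: m i => [|m IH] i; first by rewrite addn0.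
have /and3P[ok_o _ _] := fetch_ok pc.
by rewrite arunS step_scan // transduce_cell // -cells_rev IH addSnnS.
Qed.

Lemma run_left pc s i r : pc <= (size prog).+2 ->
  srun i.+1 (go_left pc, rev (cells s 0 i), inr (cell s i) :: r) =
  (enter pc, [::], cells s 0 i.+1 ++ r).
Proof.
move=> le_pc; elim: i r => [|i IH] r; first by rewrite /arun /= inordK.
rewrite arunS cells_rev [X in srun _ X]/= inordK //.
rewrite IH -[i.+2]addn1 /cells [in RHS]iotaD map_cat -catA //.
Qed.

Definition tape N s (m : nat) : seq symb := cells s 0 N ++ nseq m (raw _ 0).

Lemma run_instr N pc s m : pc <= size prog -> 0 < N ->
  let: (pc', s') := vm_step N (pc, s) in
  pc' <= (size prog).+2 /\
  srun (2 * N).+1 (scan_right pc false, [::], tape N s m) =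
    (enter pc', [::], tape N s' (maxn m 1)).
Proof.
move=> le_pc N_gt0; rewrite /vm_step.
have le_pc2 : pc <= (size prog).+2 by lia.
have /and3P[ok_o ok_t ok_f] := fetch_ok pc.
have sc := @run_scan pc s N 0 (nseq m (raw _ 0)) le_pc2.
case E: (fetch pc) => [[o t] f] in ok_o ok_t ok_f sc *.
move: ok_t ok_f sc => /= ok_t ok_f sc.
split; first by case: ifP.
have s0 : scan o s 0 = false by case: (o) => //= *; rewrite ltn0 andbF.
(* [N] steps to the right, the turn on the blank, and [N] steps back, the last of which enters the
   next instruction. *)
have -> : (2 * N).+1 = N + N.+1 by lia.
rewrite arunD /tape.
rewrite s0 in sc; rewrite sc add0n.
case: N N_gt0 {sc} => // N _.
rewrite arunS cells_rev step_turn // E run_left //.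
by case: ifP.
Qed.

(** Only addresses below [size prog] are executed, so a run that arrives at [size prog] has not yet
    made the final comparison. *)
Fixpoint vm_reach N t (c c' : nat * store) : Prop :=
  if t is t'.+1 then c.1 < size prog /\ vm_reach N t' (vm_step N c) c' else c = c'.

Lemma vm_reach_trans N t1 t2 c1 c2 c3 :
  vm_reach N t1 c1 c2 -> vm_reach N t2 c2 c3 -> vm_reach N (t1 + t2) c1 c3.
Proof.
elim: t1 c1 => [|t1 IH] c1 /=; first by move->.
by case=> lt_pc r12 r23; split=> //; apply: IH r12 r23.
Qed.

Lemma enter_scan pc : pc <= size prog -> enter pc = scan_right pc false.
Proof. by move=> le_pc; rewrite /enter; do 2 (case: eqP => [|_]; first by lia). Qed.

Lemma run_vm N t pc s pc' s' m : 0 < N -> pc' <= size prog ->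
  vm_reach N t (pc, s) (pc', s') ->
  exists m', srun (t * (2 * N).+1) (enter pc, [::], tape N s m) =
    (enter pc', [::], tape N s' m').
Proof.
move=> N_gt0 le_pc'; elim: t pc s m => [|t IH] pc s m.
  by case=> -> ->; exists m.
case=> lt_pc reach.
have := @run_instr N pc s m (ltnW lt_pc) N_gt0.
case E: (vm_step N (pc, s)) => [pc1 s1] [_ run1].
have [m' run2] := IH pc1 s1 (maxn m 1) ltac:(by rewrite -E).
by exists m'; rewrite mulSn arunD enter_scan ?run1 // ltnW.
Qed.

(** On an encoded instance array 0 holds the matrix below the separator and the binary digits of k
    above it. The separator sits at position n * n, from which n is recovered. *)
Definition load_store (w : seq 'I_3) m :=
  Store (fun x => if x == 0 then m else if x == 1 then size w else 0)
        (fun a p => (a == 0) && (nth symH w p == sym1)).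

Lemma val_inord4 (i : 'I_3) : (inord i.+1 : 'I_4) = i.+1 :> nat.
Proof. by rewrite inordK // ltnS ltn_ord. Qed.

Section Load.

Variables (w : seq 'I_3) (m : nat).
Hypothesis m_bounds : 0 < m < size w.
Hypothesis mP : forall p, p < size w -> (nth symH w p == symH) = (p == m).

Let s0 := load_store w m.

Lemma load_cellE p : p < size w -> load_cell (p == 0) (nth symH w p).+1 = cell s0 p.
Proof.
move=> lt_p; rewrite /load_cell /cell; congr (_, _, _); apply/ffunP => x; rewrite !ffunE /=.
  case: eqP => _; first by rewrite [m == p]eq_sym -mP // -val_eqE /= inordK.
  case: eqP => _; [lia | exact: eq_sym].
by case: eqP => //= _; rewrite -val_eqE /= inordK.
Qed.

Lemma load_cell_end : load_cell false 0 = cell s0 (size w).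
Proof.
have w_neq0 : (size w == 0) = false by lia.
rewrite /load_cell /cell w_neq0; congr (_, _, _); apply/ffunP => x; rewrite !ffunE /=.
  case: eqP => _; first by lia.
  by case: eqP => _; rewrite ?eqxx // eq_sym w_neq0.
by case: eqP => //= _; rewrite nth_default // -val_eqE /= !inordK.
Qed.

Lemma run_loading i : 0 < i <= size w ->
  srun i (ainit _ cell_type w) =
  (loading, rev (cells s0 0 i), [seq raw _ j.+1 | j : 'I_3 <- drop i w]).
Proof.
case: i => // i; elim: i => [|i IH] /= lt_i.
  rewrite /arun /ainit /= -(drop0 w) (drop_nth symH) /=; last by lia.
  rewrite drop0 not_halting_start val_inord4.
  have /negbTE: nth symH w 0 != symH by rewrite mP ?eqn_leq; lia.
  rewrite -val_eqE /= inordK // => e; rewrite eqSS e.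
  by rewrite cells_rev -load_cellE.
rewrite /arun iterS -/(arun _ _ _) IH ?(ltnW lt_i) // [in RHS]cells_rev.
rewrite (drop_nth symH) //= val_inord4 /=.
by rewrite -load_cellE.
Qed.

Lemma run_load :
  srun (2 * size w).+1 (ainit _ cell_type w) =
  (scan_right 0 false, [::], tape (size w).+1 s0 0).
Proof.
have -> : (2 * size w).+1 = size w + (size w).+1 by lia.
rewrite arunD run_loading ?leqnn ?andbT; last by lia.
rewrite arunS drop_size -enter_scan //.
case E: (size w) => [|i]; first by lia.
rewrite cells_rev.
set c := astep _ _.
have -> : c = (go_left 0, rev (cells s0 0 i),
               inr (cell s0 i) :: [:: inr (load_cell false 0)]).
  by rewrite /c /= inordK.
rewrite run_left // load_cell_end E /tape cats0.
by rewrite -[i.+2]addn1 /cells [in RHS]iotaD map_cat.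
Qed.

(** Loading costs the first summand. Each instruction is one sweep over [(size w).+1] cells, and the
    final comparison is the extra sweep in [t.+1]. *)
Lemma decides_of_vm t tmax s (P : Prop) :
  vm_reach (size w).+1 t (0, s0) (size prog, s) ->
  (2 * size w).+1 + t.+1 * (2 * (size w).+1).+1 <= tmax ->
  (scan (Eq final.1 final.2) s (size w).+1 = false <-> P) ->
  decides_within (machine sweep_delta) w tmax P.
Proof.
move=> reach le_t resP.
have [|m' run1] := run_vm 0 (ltn0Sn _) _ reach; first by [].
have := @run_instr (size w).+1 (size prog) s m' (leqnn _) isT.
rewrite /vm_step /fetch nth_default //.
case=> _ run2.
apply: (@decides_of_arun _ _ _ w _ _ _ (~~ scan (Eq final.1 final.2) s (size w).+1)) le_t _.
  rewrite [t.+1 * _]mulSnr addnA !arunD run_load -enter_scan // run1.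
  rewrite (enter_scan (leqnn _)) run2 /enter.
  case: (scan (Eq _ _) _ _); last by rewrite eqxx.
  by rewrite eqSS gtn_eqF // eqxx.
by rewrite -resP; case: scan.
Qed.

End Load.

Lemma decides_head_sep w tmax (P : Prop) : 0 < tmax -> P ->
  decides_within (machine sweep_delta) (symH :: w) tmax P.
Proof.
move=> t_gt0 HP; apply: (@decides_of_arun _ _ _ _ 1 _ _ true) => //.
by rewrite /arun /= not_halting_start !inordK.
Qed.

End SweepMachine.

Arguments vm_step : simpl never.

(** * While programs *)

Inductive test := TEq of nat & nat | TRead of nat & nat.

Definition op_of_test t := match t with TEq x y => Eq x y | TRead a x => Read a x end.

(** In [While hv b t c] the body is repeated as long as [t] evaluates to [b]; [hv] has no effect on
    the compiled code and matters for time bounds only. *)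
Inductive cmd :=
  | Skip
  | Do of op
  | Seq of cmd & cmd
  | If of test & cmd & cmd
  | While of bool & bool & test & cmd.

Definition holds N t s := scan (op_of_test t) s N.

Fixpoint csize c :=
  match c with
  | Skip | Do _ => 1
  | Seq a b => csize a + csize b
  | If _ a b => (csize a + csize b).+1
  | While _ _ _ a => (csize a).+1
  end.

(* [compile c o nx] is code to be placed at address [o] that continues at [nx]. *)
Fixpoint compile c o nx : seq instr :=
  match c with
  | Skip => [:: (Eq 0 0, nx, nx)]
  | Do p => [:: (p, nx, nx)]
  | Seq a b => compile a o (o + csize a) ++ compile b (o + csize a) nx
  | If t a b => (op_of_test t, o.+1, o.+1 + csize a) ::
                compile a o.+1 nx ++ compile b (o.+1 + csize a) nx
  | While _ b t a => (op_of_test t, if b then o.+1 else nx, if b then nx else o.+1) ::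
                     compile a o.+1 o
  end.

Lemma size_compile c o nx : size (compile c o nx) = csize c.
Proof.
elim: c o nx => //= [a IHa b IHb|t a IHa b IHb|_ b t a IHa] o nx.
- by rewrite size_cat IHa IHb.
- by rewrite size_cat IHa IHb.
- by rewrite IHa.
Qed.

Section Weakest.

Variables N E : nat.

(* The first flag of [While] selects the bound on the number of iterations:
   [E] if it is set, [N] otherwise. *)
Definition loop_bound (heavy : bool) := if heavy then E else N.

Fixpoint bnd c :=
  match c with
  | Skip | Do _ => 1
  | Seq a b => bnd a + bnd b
  | If _ a b => (bnd a + bnd b).+1
  | While hv _ _ a => (loop_bound hv * (bnd a).+1).+1
  end.

(** A loop comes with its exact number [m] of iterations and an invariant indexed by the iteration.
    As [m] is at most [loop_bound], a proof of [wp] certifies termination within [bnd c]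
    instructions as well. *)
Fixpoint wp c (s : store) (R : store -> Prop) : Prop :=
  match c with
  | Skip => R s
  | Do o => R (do_op o s)
  | Seq a b => wp a s (fun s' => wp b s' R)
  | If t a b => if holds N t s then wp a s R else wp b s R
  | While hv b t a => exists m (I : nat -> store -> Prop),
      [/\ m <= loop_bound hv, I 0 s,
          forall i s', i < m -> I i s' -> holds N t s' = b /\ wp a s' (I i.+1)
        & forall s', I m s' -> holds N t s' = ~~ b /\ R s']
  end.

Lemma wp_mono c s (R R' : store -> Prop) :
  (forall s', R s' -> R' s') -> wp c s R -> wp c s R'.
Proof.
elim: c s R R' => //= [|o|a IHa b IHb|t a IHa b IHb|hv b t a IHa] s R R' RR'; try exact: RR'.
- by apply: IHa => s1; apply: IHb.
- by case: ifP => _; [apply: IHa | apply: IHb].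
- case=> m [I [le_m I0 IS Im]]; exists m, I; split=> // s' /Im[? ?]; split=> //; exact: RR'.
Qed.

Variables (prog : seq instr) (final : nat * nat).

Notation reach := (vm_reach prog final N).

Lemma vm_step_at l o t f r s : prog = l ++ (o, t, f) :: r ->
  size l < size prog /\
  vm_step prog final N (size l, s) = (if scan o s N then t else f, do_op o s).
Proof.
move=> ->; rewrite size_cat /= addnS ltnS leq_addr; split=> //.
by rewrite /vm_step /fetch nth_cat ltnn subnn.
Qed.

Lemma do_test t s : do_op (op_of_test t) s = s.
Proof. by case: t. Qed.

(** The code may lie between arbitrary [l] and [r], so the induction hypotheses apply to subcommands
    in place. *)
Lemma wp_sound c s R l r nx : wp c s R -> prog = l ++ compile c (size l) nx ++ r ->
  exists t s', [/\ t <= bnd c, reach t (size l, s) (nx, s') & R s'].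
Proof.
elim: c s R l r nx => [|o|a IHa b IHb|t a IHa b IHb|hv b t a IHa] s R l r nx /=.
- move=> Rs eq_p; exists 1, s; split=> //=.
  by have [lt_l ->] := vm_step_at s eq_p; split=> //; case: ifP.
- move=> Rs eq_p; exists 1, (do_op o s); split=> //=.
  (* The sweep of an [Inc] may end with the carried bit set, when the mark leaves the tape; hence
     both targets are [nx]. *)
  by have [lt_l ->] := vm_step_at s eq_p; split=> //; case: ifP.
- move=> wpa eq_p.
  have [|t1 [s1 [le1 r1 wpb]]] := 
      IHa _ _ l (compile b (size l + csize a) nx ++ r) (size l + csize a) wpa.
    by rewrite eq_p -!catA.
  have eq_l : size l + csize a = size (l ++ compile a (size l) (size l + csize a)).
    by rewrite size_cat size_compile.
  have [|t2 [s2 [le2 r2 R2]]] := IHb _ _ (l ++ compile a (size l) (size l + csize a)) r nx wpb.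
    by rewrite -eq_l eq_p -!catA.
  exists (t1 + t2), s2; split=> //; first exact: leq_add.
  by apply: vm_reach_trans r1 _; rewrite eq_l.
- move=> wpi eq_p.
  have [lt_l step1] := vm_step_at s eq_p.
  rewrite do_test -/(holds N t s) in step1.
  case: ifP wpi step1 => _ wpi step1.
  + set l' := rcons l (op_of_test t, (size l).+1, (size l).+1 + csize a).
    have eq_l : (size l).+1 = size l' by rewrite size_rcons.
    have [|t1 [s1 [le1 r1 R1]]] :=
        IHa _ _ l' (compile b ((size l).+1 + csize a) nx ++ r) nx wpi.
      by rewrite -eq_l eq_p cat_rcons -!catA.
    exists t1.+1, s1; split=> //; first by rewrite ltnS (leq_trans le1) ?leq_addr.
    by split=> //; rewrite step1 eq_l.
  + set l' := rcons l (op_of_test t, (size l).+1, (size l).+1 + csize a) ++ compile a (size l).+1 nx.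
    have eq_l : (size l).+1 + csize a = size l'.
      by rewrite size_cat size_rcons size_compile.
    have [|t1 [s1 [le1 r1 R1]]] := IHb _ _ l' r nx wpi.
      by rewrite -eq_l eq_p /l' cat_rcons -!catA.
    exists t1.+1, s1; split=> //; first by rewrite ltnS (leq_trans le1) ?leq_addl.
    by split=> //; rewrite step1 eq_l.
- case=> m [I [le_m I0 IS Im]] eq_p.
  suff [t' [s' [le_t r' Is']]] : exists t' s',
      [/\ t' <= (m * (bnd a).+1).+1, reach t' (size l, s) (nx, s') & R s'].
    exists t', s'; split=> //; apply: leq_trans le_t _; by rewrite ltnS leq_mul2r le_m orbT.
  (* Induction on the number [d] of iterations still to be made, so the invariant is taken at index
     [m - d]. *)
  have: forall d, d <= m -> forall s, I (m - d) s -> exists t' s',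
      [/\ t' <= (d * (bnd a).+1).+1, reach t' (size l, s) (nx, s') & R s'].
    elim=> [|d IHd] lt_d s1.
      rewrite subn0 => /Im[tst Rs1]; exists 1, s1; split=> //=.
      have [lt_l ->] := vm_step_at s1 eq_p; split=> //.
      by rewrite -/(holds N t s1) tst do_test; case: (b).
    have lt_i : m - d.+1 < m by lia.
    case/IS=> // tst wpa.
    have [lt_l step1] := vm_step_at s1 eq_p.
    have {}step1 : vm_step prog final N (size l, s1) = ((size l).+1, s1).
      by rewrite step1 -/(holds N t s1) tst do_test; case: (b).
    set l' := rcons l (op_of_test t, if b then (size l).+1 else nx, if b then nx else (size l).+1).
    have eq_l : (size l).+1 = size l' by rewrite size_rcons.
    have [|t1 [s2 [le1 r1 I2]]] := IHa _ _ l' r (size l) wpa.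
      by rewrite -eq_l eq_p cat_rcons.
    have [| |t2 [s3 [le2 r2 R3]]] := IHd _ s2; first exact: ltnW.
      by rewrite -subSn // subSS in I2.
    exists (t1.+1 + t2), s3; split=> //; first by lia.
    apply: vm_reach_trans r2; split=> //.
    by rewrite step1 eq_l.
  by move=> /(_ m (leqnn m) s); rewrite subnn; apply.
Qed.

(** * What a command leaves unchanged *)

Definition agree (vs ars : seq nat) s s' :=
  (forall x, x \notin vs -> sv s' x = sv s x) /\
  (forall a, a \notin ars -> forall p, sa s' a p = sa s a p).

Definition op_vmods o := match o with Zero x | Copy x _ | Inc x => [:: x] | _ => [::] end.
Definition op_amods o := if o is Write a _ _ then [:: a] else [::].

Fixpoint mods (f : op -> seq nat) c : seq nat :=
  match c with
  | Skip => [::]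
  | Do o => f o
  | Seq a b | If _ a b => mods f a ++ mods f b
  | While _ _ _ a => mods f a
  end.

Definition framed c := agree (mods op_vmods c) (mods op_amods c).

Lemma agree_trans vs ars s1 s2 s3 :
  agree vs ars s1 s2 -> agree vs ars s2 s3 -> agree vs ars s1 s3.
Proof.
move=> [v12 a12] [v23 a23]; split=> [x nx|a na p]; first by rewrite v23 ?v12.
by rewrite a23 ?a12.
Qed.

Lemma agree_sub vs ars vs' ars' s s' : {subset vs <= vs'} -> {subset ars <= ars'} ->
  agree vs ars s s' -> agree vs' ars' s s'.
Proof.
move=> sv_ sa_ [Hv Ha]; split=> [x|a] nx; [apply: Hv | apply: Ha];
  by apply: contra nx; auto.
Qed.

(** A loop invariant can always be strengthened by agreement with the entry state. The invariants
    below therefore mention only what the loop changes. *)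
Lemma wp_frame c s R : wp c s R -> wp c s (fun s' => R s' /\ framed c s s').
Proof.
rewrite /framed; elim: c s R => [|o|a IHa b IHb|t a IHa b IHb|hv b t a IHa] s R /=.
- by move=> ?; split.
- move=> Rs; split=> //; split.
    case: o Rs => //= [y|y z|y] _ x; rewrite inE => /negbTE ne;
      by case: PeanoNat.Nat.eqb_spec => // e; rewrite e eqxx in ne.
  case: o Rs => //= y z bb _ x; rewrite inE => /negbTE ne p.
  by case: PeanoNat.Nat.eqb_spec => // e; rewrite e eqxx in ne.
- move=> /IHa; apply: wp_mono => s1 [/IHb wpb fa]; apply: wp_mono wpb => s2 [Rs2 fb].
  split=> //; apply: (@agree_trans _ _ s s1 s2); [move: fa | move: fb];
    by apply: agree_sub => x; rewrite mem_cat => ->; rewrite ?orbT.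
- case: ifP => _ => [/IHa|/IHb]; apply: wp_mono => s' [Rs' fr]; split=> //;
    by move: fr; apply: agree_sub => x; rewrite mem_cat => ->; rewrite ?orbT.
- case=> m [I [le_m I0 IS Im]].
  exists m, (fun i s' => I i s' /\ agree (mods op_vmods a) (mods op_amods a) s s').
  split=> // [i s' lt_i [Is' fr]|s' [/Im[? ?] fr]]; last by split.
  have [tst /IHa wpa] := IS i s' lt_i Is'; split=> //.
  by apply: wp_mono wpa => s2 [Is2 fr2]; split=> //; apply: agree_trans fr fr2.
Qed.

Lemma wp_while hv b t c s R m (I : nat -> store -> Prop) :
  m <= loop_bound hv -> I 0 s ->
  (forall i s', i < m -> framed c s s' -> I i s' -> holds N t s' = b /\ wp c s' (I i.+1)) ->
  (forall s', framed c s s' -> I m s' -> holds N t s' = ~~ b /\ R s') ->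
  wp (While hv b t c) s R.
Proof.
move=> le_m I0 IS Im; exists m, (fun i s' => I i s' /\ framed c s s'); split=> //.
  move=> i s' lt_i [Is' fr]; have [tst /wp_frame wpc] := IS i s' lt_i fr Is'; split=> //.
  by apply: wp_mono wpc => s2 [Is2 fr2]; split=> //; apply: agree_trans fr fr2.
by move=> s' [Is' fr]; apply: Im.
Qed.

End Weakest.

(** * Polynomial time bounds from the nesting of loops *)

Fixpoint loop_depth (hv : bool) c : nat :=
  match c with
  | Skip | Do _ => 0
  | Seq a b | If _ a b => maxn (loop_depth hv a) (loop_depth hv b)
  | While hv' _ _ a => (hv' == hv) + loop_depth hv a
  end.

(** The weight of a loop comes from B * (w * X + 1) + 1 <= (w + 2) * B * X, valid for B, X >= 1,
    where B bounds the iterations and w * X the body. *)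
Fixpoint weight c : nat :=
  match c with
  | Skip | Do _ => 1
  | Seq a b => weight a + weight b
  | If _ a b => (weight a + weight b).+1
  | While _ _ _ a => (weight a).+2
  end.

Lemma bnd_le N E c : 0 < N -> 0 < E ->
  bnd N E c <= weight c * (N ^ loop_depth false c * E ^ loop_depth true c).
Proof.
move=> N0 E0.
have mono a b a' b' : a <= a' -> b <= b' -> N ^ a * E ^ b <= N ^ a' * E ^ b'.
  by move=> la lb; rewrite leq_mul // leq_pexp2l.
have pos a b : 0 < N ^ a * E ^ b by rewrite muln_gt0 !expn_gt0 N0 E0.
elim: c => [||a IHa b IHb|t a IHa b IHb|hv b t a IHa] //=.
- rewrite mulnDl leq_add //; [apply: leq_trans IHa _ | apply: leq_trans IHb _];
    by rewrite leq_mul2l mono ?orbT ?leq_maxl ?leq_maxr.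
- rewrite mulSn mulnDl -add1n leq_add ?pos // leq_add //;
    [apply: leq_trans IHa _ | apply: leq_trans IHb _];
    by rewrite leq_mul2l mono ?orbT ?leq_maxl ?leq_maxr.
- set d := loop_depth false a in IHa *; set e := loop_depth true a in IHa *.
  set X := N ^ d * E ^ e in IHa; set w := weight a in IHa *.
  have -> : N ^ ((hv == false) + d) * E ^ ((hv == true) + e) = loop_bound N E hv * X.
    by case: (hv); rewrite /= ?add1n ?add0n expnS /X; lia.
  have B0 : 0 < loop_bound N E hv by case: (hv).
  have X0 : 0 < X := pos d e.
  rewrite -addn2 mulnDl; apply: (@leq_ltn_trans (loop_bound N E hv * (w * X).+1)).
    by rewrite leq_mul2l ltnS IHa orbT.
  nia.
Qed.

(** * Reading the instance and computing the h-index *)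

Arguments wp : simpl never.
Arguments framed : simpl never.
Arguments Nat.eqb : simpl nomatch.

Lemma wp_skipE N E s R : wp N E Skip s R = R s.
Proof. by []. Qed.
Lemma wp_doE N E o s R : wp N E (Do o) s R = R (do_op o s).
Proof. by []. Qed.
Lemma wp_seqE N E c1 c2 s R : wp N E (Seq c1 c2) s R = wp N E c1 s (fun s' => wp N E c2 s' R).
Proof. by []. Qed.
Lemma wp_ifE N E t c1 c2 s R :
  wp N E (If t c1 c2) s R = if holds N t s then wp N E c1 s R else wp N E c2 s R.
Proof. by []. Qed.
Definition wpE := (wp_seqE, wp_skipE, wp_doE, wp_ifE).

Lemma framed_sv c s s' : framed c s s' ->
  forall x, x \notin mods op_vmods c -> sv s' x = sv s x.
Proof. by case. Qed.

Lemma framed_sa c s s' : framed c s s' ->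
  forall a, a \notin mods op_amods c -> sa s' a =1 sa s a.
Proof. by case. Qed.

Local Notation "c1 ;; c2" := (Seq c1 c2) (at level 60, right associativity).

(** [vM] is n * n, [vEND] the input length, [vK] is min(n, k), [vH] the h-index, [vC] the current
    candidate, [vSZ] its size capped at [vK]. [vP] is a position in the input, [vU] and [vW] are row
    and column, [vCUR] is the size of the growing cover, [vBAD] counts failures and [vRES]
    successes. [aBIG] holds the vertices of degree at least h, [aX] the candidate, [aY] the growing
    cover, [aG] the guess string. [vSQ] is first a square, later a matrix position. *)
Local Notation vM := 0 (only parsing).
Local Notation vEND := 1 (only parsing).
Local Notation vZERO := 2 (only parsing).
Local Notation vN := 3 (only parsing).
Local Notation vK := 4 (only parsing).
Local Notation vH := 5 (only parsing).
Local Notation vC := 6 (only parsing).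
Local Notation vP := 7 (only parsing).
Local Notation vU := 8 (only parsing).
Local Notation vW := 9 (only parsing).
Local Notation vD := 10 (only parsing).
Local Notation vSZ := 11 (only parsing).
Local Notation vCUR := 12 (only parsing).
Local Notation vBAD := 13 (only parsing).
Local Notation vRES := 14 (only parsing).
Local Notation vQ := 15 (only parsing).
Local Notation vT := 16 (only parsing).
Local Notation vJ := 17 (only parsing).
Local Notation vCNT := 18 (only parsing).
Local Notation vPW := 19 (only parsing).
Local Notation vSQ := 20 (only parsing).
Local Notation aADJ := 0 (only parsing).
Local Notation aBIG := 1 (only parsing).
Local Notation aX := 2 (only parsing).
Local Notation aY := 3 (only parsing).
Local Notation aG := 4 (only parsing).

Local Notation Until := (While false false) (only parsing).

(** The summand is copied first, so that [x] and [y] may coincide; doubling uses this. *)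
Definition AddCapped cap x y :=
  Do (Copy vQ y);; Do (Zero vT);;
  Until (TEq vT vQ) (Do (Inc vT);; If (TEq x cap) Skip (Do (Inc x))).

(** The square root of n * n is found by running through the squares: (i + 1)^2 = i^2 + i + i +
    1. *)
Definition FindN :=
  Until (TEq vSQ vM)
    (AddCapped vM vSQ vN;; AddCapped vM vSQ vN;; Do (Inc vSQ);; Do (Inc vN)).

(** Both the partial value and the current power of two are capped at n. Capping summands before a
    capped addition does not alter its result, so min(n, k) comes out. *)
Definition ReadK :=
  Do (Copy vP vM);; Do (Inc vP);; Do (Inc vPW);;
  Until (TEq vP vEND)
    (If (TRead aADJ vP) (AddCapped vN vK vPW) Skip;; AddCapped vN vPW vPW;; Do (Inc vP)).

(** The count stops at [vJ], so [vD = vJ] afterwards means that the degree is at least [vJ]. *)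
Definition RowDegree :=
  Do (Zero vD);; Do (Zero vU);;
  Until (TEq vU vN)
    (If (TRead aADJ vP) (If (TEq vD vJ) Skip (Do (Inc vD))) Skip;;
     Do (Inc vP);; Do (Inc vU)).

Definition CountLarge :=
  Do (Zero vCNT);; Do (Zero vP);; Do (Zero vW);;
  Until (TEq vW vN)
    (RowDegree;; If (TEq vD vJ) (If (TEq vCNT vJ) Skip (Do (Inc vCNT))) Skip;; Do (Inc vW)).

(** Having at least j vertices of degree at least j is downward closed in j, so the search may stop
    at the first failure; [vH] keeps the last success. *)
Definition FindH :=
  While false true (TEq vCNT vJ) (Do (Copy vH vJ);; Do (Inc vJ);; CountLarge).

Definition valb (bs : seq bool) : nat := foldr (fun (b : bool) v => b + 2 * v) 0 bs.

Lemma valb_rcons bs b : valb (rcons bs b) = valb bs + b * 2 ^ size bs.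
Proof. by elim: bs => [|c bs IH] /=; rewrite ?IH ?expnS; lia. Qed.

(** * Correctness of reading n and k and of computing the h-index *)

Section Phases.

Variables N E : nat.
Notation wp := (wp N E).

Lemma wp_AddCapped cap x y s R :
  [&& x != vQ, x != vT, cap != vQ, cap != vT & cap != x] ->
  sv s x <= sv s cap -> sv s cap < N -> sv s y < N ->
  (forall s', framed (AddCapped cap x y) s s' ->
     sv s' x = minn (sv s cap) (sv s x + sv s y) -> R s') ->
  wp (AddCapped cap x y) s R.
Proof.
case/and5P=> /eqP xQ /eqP xT /eqP cQ /eqP cT /eqP cx le_x lt_c lt_y HR.
have eqF u v : u <> v -> Nat.eqb u v = false by move/PeanoNat.Nat.eqb_neq.
suff : wp (AddCapped cap x y) s (fun s' => sv s' x = minn (sv s cap) (sv s x + sv s y)).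
  by move/wp_frame; apply: wp_mono => s' [? ?]; apply: HR.
rewrite !wpE /=; set s0 := setv vT _ _.
have s0x : sv s0 x = sv s x by rewrite /= (eqF _ _ xT) (eqF _ _ xQ).
have s0c : sv s0 cap = sv s cap by rewrite /= (eqF _ _ cT) (eqF _ _ cQ).
have s0Q : sv s0 vQ = sv s y by [].
have notin z : z <> vT -> z <> x -> z \notin mods op_vmods
   (Do (Inc vT);; If (TEq x cap) Skip (Do (Inc x))).
  by move=> /eqP zT /eqP zx; rewrite /= !inE negb_or zT zx.
apply: (@wp_while _ _ _ _ _ _ _ _ (sv s y)
  (fun i s' => sv s' vT = i /\ sv s' x = minn (sv s cap) (sv s x + i))) => //=.
- exact: ltnW.
- split=> //; change (sv s0 x = minn (sv s cap) (sv s x + 0)).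
  by rewrite s0x; lia.
- move=> i s' lt_i fr [sT sx].
  have sQ : sv s' vQ = sv s y by rewrite (framed_sv fr) ?s0Q // notin //; exact: nesym.
  have sc : sv s' cap = sv s cap by rewrite (framed_sv fr) ?s0c // notin.
  rewrite /holds /= sT sQ; split; first by lia.
  rewrite !wpE /holds /= (eqF _ _ xT) (eqF _ _ cT) sx sc sT.
  case: ifP => [/andP[/eqP e _]|ne]; rewrite /= ?wpE /= ?(eqF _ _ xT) ?sx ?sT.
    by split=> //; lia.
  rewrite PeanoNat.Nat.eqb_refl (eqF vT x) ?sT; last by move=> e; apply: xT.
  by split=> //; lia.
- move=> s' fr [sT sx].
  have sQ : sv s' vQ = sv s y by rewrite (framed_sv fr) ?s0Q // notin //; exact: nesym.
  by rewrite /holds /= sT sQ eqxx lt_y sx.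
Qed.

Lemma wp_FindN n s (R : store -> Prop) : 0 < n -> n * n < N -> sv s vM = n * n ->
  sv s vSQ = 0 -> sv s vN = 0 ->
  (forall s', framed FindN s s' -> sv s' vN = n -> R s') ->
  wp FindN s R.
Proof.
move=> n0 ltN sM sSQ sN HR.
suff : wp FindN s (fun s' => sv s' vN = n).
  by move/wp_frame; apply: wp_mono => s' [? ?]; apply: HR.
apply: (@wp_while _ _ _ _ _ _ _ _ n
  (fun i s' => sv s' vN = i /\ sv s' vSQ = i * i)) => //=.
- by rewrite /loop_bound; nia.
- move=> i s1 lt_i fr [s1N s1SQ].
  have s1M : sv s1 vM = n * n by rewrite (framed_sv fr).
  rewrite /holds /= s1M s1SQ; split; first by nia.
  rewrite wp_seqE; apply: wp_AddCapped => //; rewrite ?s1M ?s1SQ ?s1N //; try nia.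
  move=> s2 fr2 s2SQ.
  have s2M : sv s2 vM = n * n by rewrite (framed_sv fr2).
  have s2N : sv s2 vN = i by rewrite (framed_sv fr2).
  rewrite wp_seqE; apply: wp_AddCapped => //; rewrite ?s2M ?s2SQ ?s2N //; try nia.
  move=> s3 fr3 s3SQ.
  have s3N : sv s3 vN = i by rewrite (framed_sv fr3).
  rewrite !wpE /= s3N s3SQ; split=> //; nia.
- move=> s1 fr [s1N s1SQ].
  have s1M : sv s1 vM = n * n by rewrite (framed_sv fr).
  by rewrite /holds /= s1M s1SQ eqxx ltN.
Qed.

Lemma wp_ReadK n bs s (R : store -> Prop) : 0 < n -> n * n < N ->
  sv s vM = n * n -> sv s vN = n -> sv s vK = 0 -> sv s vPW = 0 ->
  sv s vEND = (n * n).+1 + size bs -> sv s vEND < N ->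
  (forall i, i < size bs -> sa s aADJ ((n * n).+1 + i) = nth false bs i) ->
  (forall s', framed ReadK s s' -> sv s' vK = minn n (valb bs) -> R s') ->
  wp ReadK s R.
Proof.
move=> n0 ltN sM sN sK sPW sE ltE sA HR.
suff : wp ReadK s (fun s' => sv s' vK = minn n (valb bs)).
  by move/wp_frame; apply: wp_mono => s' [? ?]; apply: HR.
rewrite !wpE /=; set s0 := setv vPW _ _.
have ltn : n < N by nia.
apply: (@wp_while _ _ _ _ _ _ _ _ (size bs)
  (fun i s' => [/\ sv s' vP = (n * n).+1 + i, sv s' vPW = minn n (2 ^ i) &
      sv s' vK = minn n (valb (take i bs))])) => //=.
- by rewrite /loop_bound; lia.
- rewrite sM sPW sK take0 addn0; split=> //; lia.
- move=> i s1 lt_i fr [s1P s1PW s1K].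
  have s1E : sv s1 vEND = (n * n).+1 + size bs by rewrite (framed_sv fr).
  have s1N : sv s1 vN = n by rewrite (framed_sv fr).
  rewrite /holds /= s1P s1E; split; first by lia.
  have ltP : (n * n).+1 + i < N by lia.
  rewrite (take_nth false) // valb_rcons size_take lt_i.
  have: sa s1 aADJ ((n * n).+1 + i) = nth false bs i by rewrite (framed_sa fr) //= sA.
  rewrite wp_seqE wp_ifE /holds /= s1P ltP andbT => ->.
  suff step : forall s2, sv s2 vP = (n * n).+1 + i -> sv s2 vPW = minn n (2 ^ i) ->
     sv s2 vN = n -> sv s2 vK = minn n (valb (take i bs) + nth false bs i * 2 ^ i) ->
     wp (AddCapped vN vPW vPW;; Do (Inc vP)) s2 (fun s' =>
        [/\ sv s' vP = (n * n).+1 + i.+1, sv s' vPW = minn n (2 ^ i.+1) &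
          sv s' vK = minn n (valb (take i bs) + nth false bs i * 2 ^ i)]).
    case: (nth false bs i) step => step.
      apply: wp_AddCapped => //; rewrite ?s1N ?s1K ?s1PW //; try lia.
      move=> s2 fr2 s2K; apply: step; rewrite ?s2K ?(framed_sv fr2) ?s1P ?s1PW ?s1N //; lia.
    apply: step => //; rewrite s1K; lia.
  move=> s2 s2P s2PW s2N s2K; rewrite wp_seqE.
  apply: wp_AddCapped => //; rewrite ?s2N ?s2PW //; try lia.
  move=> s3 fr3 s3PW; rewrite !wpE /= s3PW !(framed_sv fr3) // s2P s2K expnS.
  split=> //; lia.
- move=> s1 fr [s1P s1PW s1K].
  have s1E : sv s1 vEND = (n * n).+1 + size bs by rewrite (framed_sv fr).
  by rewrite /holds /= s1P s1E eqxx s1K take_size -sE ltE.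
Qed.

Section Degrees.

Variables (a : nat -> bool) (n : nat).
Hypothesis n_gt0 : 0 < n.
Hypothesis N_big : (n * n).+1 < N.

Definition row_deg v := count a (iota (v * n) n).
Definition num_large j := count (fun v => j <= row_deg v) (iota 0 n).

Lemma wp_RowDegree v s (R : store -> Prop) : v < n ->
  sa s aADJ =1 a -> sv s vN = n -> sv s vP = v * n -> sv s vJ <= n.+1 ->
  (forall s', framed RowDegree s s' -> sv s' vP = v.+1 * n ->
     sv s' vD = minn (sv s vJ) (row_deg v) -> R s') ->
  wp RowDegree s R.
Proof.
move=> lt_v sA sN sP leJ HR.
suff : wp RowDegree s (fun s' => sv s' vP = v.+1 * n /\ sv s' vD = minn (sv s vJ) (row_deg v)).
  by move/wp_frame; apply: wp_mono => s' [[? ?] ?]; apply: HR.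
rewrite !wpE /=; set s0 := setv vU _ _.
apply: (@wp_while _ _ _ _ _ _ _ _ n
  (fun i s' => [/\ sv s' vU = i, sv s' vP = v * n + i &
      sv s' vD = minn (sv s vJ) (count a (iota (v * n) i))])) => //.
- by rewrite /loop_bound; nia.
- by rewrite /= sP addn0; split=> //; lia.
- move=> i s1 lt_i fr [s1U s1P s1D].
  have s1N : sv s1 vN = n by rewrite (framed_sv fr).
  have s1J : sv s1 vJ = sv s vJ by rewrite (framed_sv fr).
  have s1A : sa s1 aADJ =1 a by move=> p; rewrite (framed_sa fr) //= sA.
  have ltP : v * n + i < N by nia.
  have ltJ : sv s vJ < N by nia.
  have cS : count a (iota (v * n) i.+1) = count a (iota (v * n) i) + a (v * n + i).
    by rewrite -[in LHS]addn1 iotaD count_cat /= addn0.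
  rewrite cS /holds /= s1U s1N; split; first by lia.
  rewrite wp_seqE wp_ifE /holds /= s1P s1A ltP andbT.
  case: (a _); rewrite !wpE /holds /= ?s1D ?s1J.
    by case: ifP => [/andP[/eqP e _]|ne]; rewrite ?wpE /= ?s1U ?s1P ?s1D; split; lia.
  by rewrite ?s1U ?s1P ?s1D; split; lia.
- move=> s1 fr [s1U s1P s1D].
  have s1N : sv s1 vN = n by rewrite (framed_sv fr).
  rewrite /holds /= s1U s1N eqxx s1P s1D mulSn addnC; split=> //=; nia.
Qed.

Lemma wp_CountLarge s (R : store -> Prop) :
  sa s aADJ =1 a -> sv s vN = n -> sv s vJ <= n.+1 ->
  (forall s', framed CountLarge s s' ->
     sv s' vCNT = minn (sv s vJ) (num_large (sv s vJ)) -> R s') ->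
  wp CountLarge s R.
Proof.
move=> sA sN leJ HR.
suff : wp CountLarge s (fun s' => sv s' vCNT = minn (sv s vJ) (num_large (sv s vJ))).
  by move/wp_frame; apply: wp_mono => s' [? ?]; apply: HR.
set j := sv s vJ in leJ *.
rewrite !wpE /=; set s0 := setv vW _ _.
apply: (@wp_while _ _ _ _ _ _ _ _ n
  (fun i s' => [/\ sv s' vW = i, sv s' vP = i * n &
      sv s' vCNT = minn j (count (fun v => j <= row_deg v) (iota 0 i))])) => //.
- by rewrite /loop_bound; nia.
- move=> i s1 lt_i fr [s1W s1P s1C].
  have s1N : sv s1 vN = n by rewrite (framed_sv fr).
  have s1J : sv s1 vJ = j by rewrite (framed_sv fr).
  have s1A : sa s1 aADJ =1 a by move=> p; rewrite (framed_sa fr) //= sA.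
  have cS : count (fun v => j <= row_deg v) (iota 0 i.+1) =
            count (fun v => j <= row_deg v) (iota 0 i) + (j <= row_deg i).
    by rewrite -[in LHS]addn1 iotaD count_cat /= addn0.
  rewrite cS /holds /= s1W s1N; split; first by lia.
  rewrite wp_seqE; apply: (@wp_RowDegree i) => //; first by rewrite s1J.
  move=> s2 fr2 s2P s2D; rewrite s1J in s2D.
  have s2W : sv s2 vW = i by rewrite (framed_sv fr2).
  have s2J : sv s2 vJ = j by rewrite (framed_sv fr2).
  have s2C : sv s2 vCNT = sv s1 vCNT by rewrite (framed_sv fr2).
  have ltJ : j < N by nia.
  rewrite wp_seqE wp_ifE /holds /= s2D s2J.
  case: ifP => [e|ne]; last first.
    rewrite ?wpE /= ?s2W ?s2P ?s2C ?s1C; split=> //; lia.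
  rewrite !wpE /holds /= s2C s2J s1C.
  by case: ifP => e2; rewrite ?wpE /= ?s2W ?s2P ?s2C ?s1C; split=> //; lia.
- move=> s1 fr [s1W s1P s1C].
  have s1N : sv s1 vN = n by rewrite (framed_sv fr).
  by rewrite /holds /= s1W s1N eqxx s1C; split; first by nia.
Qed.

Variable h : nat.
Hypothesis h_le : forall j, j <= h -> j <= num_large j.
Hypothesis h_gt : num_large h.+1 <= h.

Lemma h_le_n : h <= n.
Proof.
apply: leq_trans (h_le (leqnn h)) _.
by rewrite /num_large (leq_trans (count_size _ _)) // size_iota.
Qed.

Lemma wp_FindH s (R : store -> Prop) :
  sa s aADJ =1 a -> sv s vN = n -> sv s vJ = 0 -> sv s vCNT = 0 ->
  (forall s', framed FindH s s' -> sv s' vH = h -> R s') ->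
  wp FindH s R.
Proof.
move=> sA sN sJ sC HR.
suff : wp FindH s (fun s' => sv s' vH = h).
  by move/wp_frame; apply: wp_mono => s' [? ?]; apply: HR.
have hn := h_le_n.
(* The test succeeds for the values 0, ..., [h] of [vJ] and fails at [h.+1]; [vH] lags one behind.
   The case [i = 0] is the entry, before [vH] is assigned. *)
apply: (@wp_while _ _ _ _ _ _ _ _ h.+1
  (fun i s' => [/\ sv s' vJ = i, sv s' vH = i.-1 \/ i = 0 &
                   sv s' vCNT = minn i (num_large i)])) => //=.
- by rewrite /loop_bound; nia.
- by rewrite sJ sC min0n; split=> //; right.
- move=> i s1 lt_i fr [s1J s1H s1C].
  have s1N : sv s1 vN = n by rewrite (framed_sv fr).
  have s1A : sa s1 aADJ =1 a by move=> p; rewrite (framed_sa fr) //= sA.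
  rewrite /holds /= s1J s1C; split.
    by have := h_le lt_i; nia.
  rewrite !wp_seqE !wp_doE; apply: wp_CountLarge => //=; rewrite ?s1J; first by lia.
  move=> s2 fr2 s2C; rewrite (framed_sv fr2) //= (framed_sv fr2) //= s2C ?s1J.
  by split=> //; left.
- move=> s1 fr [s1J s1H s1C].
  rewrite /holds /= s1J s1C; split; last by case: s1H.
  by lia.
Qed.

End Degrees.

End Phases.

(** * Guessing a cover *)

(** The counters stop at their thresholds: [vD = vH] will say |S| >= h, and the excess over [vK]
    goes to [vBAD], so [vBAD = 0] will say that S fits the budget. *)
Definition AddToX :=
  Do (Write aX vU true);;
  If (TEq vSZ vK) (Do (Inc vBAD)) (Do (Inc vSZ));;
  If (TEq vD vH) Skip (Do (Inc vD)).

(** [vP] is not reset here, so successive candidates read successive rows of the matrix. *)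
Definition BuildX :=
  Do (Zero vU);; Do (Zero vSZ);; Do (Zero vD);; Do (Zero vBAD);;
  Until (TEq vU vN)
    (Do (Write aX vU false);;
     If (TEq vC vN) (If (TRead aBIG vU) AddToX Skip) (If (TRead aADJ vP) AddToX Skip);;
     Do (Inc vP);; Do (Inc vU)).

Definition CopyXY :=
  Do (Zero vU);;
  Until (TEq vU vN)
    (If (TRead aX vU) (Do (Write aY vU true)) (Do (Write aY vU false));; Do (Inc vU)).

(** [vCUR] is the size of the partial cover and also the index of the next guess bit; a string thus
    uses the bits from |S| up to [vK - 1]. *)
Definition CoverEdge :=
  If (TRead aADJ vSQ)
    (If (TRead aY vU) Skip
      (If (TRead aY vW) Skip
        (If (TEq vCUR vK) (Do (Inc vBAD))
          (If (TRead aG vCUR) (Do (Write aY vU true)) (Do (Write aY vW true));;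
           Do (Inc vCUR)))))
    Skip.

Definition CoverRow :=
  Do (Zero vW);;
  Until (TEq vW vN) (CoverEdge;; Do (Inc vSQ);; Do (Inc vW)).

(** [vRES] may run off the tape. A counter without a mark still differs from 0, which is all that
    the final comparison asks. *)
Definition Check :=
  CopyXY;; Do (Copy vCUR vSZ);; Do (Zero vBAD);; Do (Zero vSQ);; Do (Zero vU);;
  Until (TEq vU vN) (CoverRow;; Do (Inc vU));;
  If (TEq vBAD vZERO) (Do (Inc vRES)) Skip.

Definition NextGuess :=
  Do (Copy vQ vSZ);;
  While false true (TRead aG vQ) (Do (Write aG vQ false);; Do (Inc vQ));;
  Do (Write aG vQ true).

(** Bit [vK] is set exactly when the binary counter overflows, after all strings have been tried. It
    is then the only bit set, and clearing it restores the zero string for the next candidate. *)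
Definition Enumerate :=
  While true false (TRead aG vK) (Check;; NextGuess);; Do (Write aG vK false).

(** For a vertex c the set N(c) has size deg(c), so the filter |S| >= h also tells whether c belongs
    to [aBIG]. This array is complete when the last candidate, which consists of it, is built. *)
Definition Candidate :=
  BuildX;;
  If (TEq vD vH) (Do (Write aBIG vC true);; If (TEq vBAD vZERO) Enumerate Skip) Skip;;
  Do (Inc vC).

Definition Search :=
  Do (Zero vP);; Do (Copy vJ vN);; Do (Inc vJ);; Until (TEq vC vJ) Candidate.

(** * Guess strings as binary counters, least significant bit first *)

Fixpoint bits_val (g : nat -> bool) p b : nat :=
  if b is b'.+1 then g p + 2 * bits_val g p.+1 b' else 0.

Lemma bits_val_last g p b : bits_val g p b.+1 = bits_val g p b + g (p + b) * 2 ^ b.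
Proof.
elim: b p => [|b IH] p; first by rewrite /= addn0; lia.
by rewrite [LHS]/= -/(bits_val _ _ b.+1) IH /= expnS addSnnS; lia.
Qed.

Lemma bits_val_lt g p b : bits_val g p b < 2 ^ b.
Proof. by elim: b p => //= b IH p; have := IH p.+1; rewrite expnS; case: (g p) => /=; lia. Qed.

Lemma bits_val_inj g g' p b : bits_val g p b = bits_val g' p b ->
  forall i, p <= i < p + b -> g i = g' i.
Proof.
elim: b p => [|b IH] p /= e i; first by lia.
have gp : g p = g' p by move: e; case: (g p); case: (g' p) => //=; lia.
case: (eqVneq i p) => [->//|ne] i_bnd; apply: (IH p.+1); last by lia.
by move: e; rewrite gp; lia.
Qed.

Lemma bits_val0 g p b : (forall i, g i = false) -> bits_val g p b = 0.
Proof. by move=> g0; elim: b p => //= b IH p; rewrite IH g0. Qed.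

Lemma bits_val_ext g g' p b : (forall i, p <= i -> g i = g' i) -> bits_val g p b = bits_val g' p b.
Proof.
elim: b p => //= b IH p e; rewrite e // (IH p.+1) // => i lt_i; apply: e; exact: ltnW.
Qed.

Lemma bits_val_next (g g' : nat -> bool) p b r : r < b ->
  (forall i, p <= i < p + r -> g i) -> (forall i, p <= i < p + r -> g' i = false) ->
  g (p + r) = false -> g' (p + r) = true -> (forall i, p + r < i -> g' i = g i) ->
  bits_val g' p b = (bits_val g p b).+1.
Proof.
elim: r p b => [|r IH] p [|b] //= lt_r g1 g'0 gr g'r e.
  rewrite addn0 in gr g'r e; rewrite gr g'r (@bits_val_ext g' g) // => i; exact: e.
have -> : bits_val g' p.+1 b = (bits_val g p.+1 b).+1.
  by apply: IH; rewrite ?addSnnS // => i i_b; [apply: g1 | apply: g'0]; lia.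
by rewrite g1 ?g'0 /=; lia.
Qed.

Section Search.

Variables N E : nat.
Notation wp := (wp N E).
Variables (a : nat -> bool) (n k h : nat).
Hypothesis n_gt0 : 0 < n.
Hypothesis N_big : (n * n).+1 < N.
Hypothesis k_le : k <= n.
Hypothesis h_le_n : h <= n.

Let n_lt : n.+1 < N. Proof. nia. Qed.

Notation row_deg := (row_deg a n).

(** These are the n + 1 candidate sets: the neighbourhoods of the vertices, and under index [n] the
    set of all vertices of degree at least [h]. *)
Definition row c u := if c == n then h <= row_deg u else a (c * n + u).
Definition row_size c := count (row c) (iota 0 n).

Lemma row_size_deg c : c < n -> row_size c = row_deg c.
Proof.
move=> lt_c; rewrite /row_size /row_deg -[in RHS](addn0 (c * n)) iotaDl count_map.
by apply: eq_count => u; rewrite /row /= ltn_eqF.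
Qed.

Lemma wp_BuildX c s (R : store -> Prop) : c <= n ->
  sa s aADJ =1 a -> sv s vN = n -> sv s vK = k -> sv s vH = h -> sv s vC = c ->
  sv s vP = c * n ->
  (c = n -> forall u, u < n -> sa s aBIG u = (h <= row_deg u)) ->
  (forall s', framed BuildX s s' -> sv s' vP = c.+1 * n ->
     sv s' vSZ = minn k (row_size c) -> sv s' vD = minn h (row_size c) ->
     sv s' vBAD = row_size c - k -> (forall u, u < n -> sa s' aX u = row c u) -> R s') ->
  wp BuildX s R.
Proof.
move=> le_c sA sN sK sH sC sP sB HR.
suff : wp BuildX s (fun s' => [/\ sv s' vP = c.+1 * n,
     sv s' vSZ = minn k (row_size c), sv s' vD = minn h (row_size c),
     sv s' vBAD = row_size c - k & (forall u, u < n -> sa s' aX u = row c u)]).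
  by move/wp_frame; apply: wp_mono => s' [[? ? ? ? ?] ?]; apply: HR.
rewrite !wpE; set s0 := do_op (Zero vBAD) _.
pose cnt i := count (row c) (iota 0 i).
apply: (@wp_while _ _ _ _ _ _ _ _ n
  (fun i s' => [/\ sv s' vU = i, sv s' vP = c * n + i,
     [/\ sv s' vSZ = minn k (cnt i), sv s' vD = minn h (cnt i) & sv s' vBAD = cnt i - k] &
     (forall u, u < i -> sa s' aX u = row c u)])) => //.
- by rewrite /loop_bound; lia.
- by rewrite /= sP; split=> //; try split; rewrite /cnt /=; lia.
- move=> i s1 lt_i fr [s1U s1P [s1S s1D s1B] s1X].
  have s1N : sv s1 vN = n by rewrite (framed_sv fr).
  have s1K : sv s1 vK = k by rewrite (framed_sv fr).
  have s1H : sv s1 vH = h by rewrite (framed_sv fr).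
  have s1C : sv s1 vC = c by rewrite (framed_sv fr).
  have s1A : sa s1 aADJ =1 a by move=> p; rewrite (framed_sa fr) //= sA.
  have s1BIG : c = n -> sa s1 aBIG i = (h <= row_deg i).
    by move=> cn; rewrite (framed_sa fr) //= sB.
  have lt_iN : i < N by lia.
  split; first by rewrite /holds /= s1U s1N; lia.
  have cS : cnt i.+1 = cnt i + row c i.
    by rewrite /cnt -[in LHS]addn1 iotaD count_cat /= addn0.
  rewrite wp_seqE wp_doE wp_seqE; set s2 := do_op _ _.
  set R2 := (fun s' => wp _ s' _).
  suff wpX : wp (if row c i then AddToX else Skip) s2 R2.
    rewrite !wp_ifE.
    have -> : holds N (TEq vC vN) s2 = (c == n) by rewrite /holds /= s1C s1N; lia.
    have -> : holds N (TRead aBIG vU) s2 = sa s1 aBIG i by rewrite /holds /= s1U lt_iN andbT.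
    case: (c =P n) wpX => [cn|ne].
      by rewrite /row cn eqxx s1BIG //; case: ifP.
    have -> : holds N (TRead aADJ vP) s2 = a (c * n + i).
      have ltP : c * n + i < N by nia.
      by rewrite /holds /= s1P s1A ltP andbT.
    by rewrite /row; case: eqP => // _; case: ifP.
  rewrite /R2 cS; case E1: (row c i) => /=; rewrite /AddToX !wpE /holds /=.
    rewrite s1S s1D s1K s1H s1B.
    have s3X : forall u, u < i.+1 ->
        (if u == sv s1 vU then true else if u == sv s1 vU then false else sa s1 aX u) = row c u.
      move=> u; rewrite s1U ltnS leq_eqVlt => /orP[/eqP->|lt_u]; first by rewrite eqxx E1.
      by rewrite ltn_eqF // s1X.
    case: ifP => e1; case: ifP => e2; rewrite ?wpE /= ?s1U ?s1P ?s1S ?s1D ?s1B; rewrite s1U in s3X;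
      (split=> //; [lia | split; lia]).
  rewrite s1U s1P s1S s1D s1B addn0; split=> //; first by lia.
  move=> u; rewrite ltnS leq_eqVlt => /orP[/eqP->|lt_u]; first by rewrite eqxx E1.
  by rewrite ltn_eqF // s1X.
- move=> s1 fr [s1U s1P [s1S s1D s1B] s1X].
  have s1N : sv s1 vN = n by rewrite (framed_sv fr).
  rewrite /holds /= s1U s1N eqxx s1P s1S s1D s1B mulSn addnC; split=> //=; lia.
Qed.

Lemma wp_CopyXY s (R : store -> Prop) : sv s vN = n ->
  (forall s', framed CopyXY s s' -> (forall u, u < n -> sa s' aY u = sa s aX u) -> R s') ->
  wp CopyXY s R.
Proof.
move=> sN HR.
suff : wp CopyXY s (fun s' => forall u, u < n -> sa s' aY u = sa s aX u).
  by move/wp_frame; apply: wp_mono => s' [? ?]; apply: HR.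
rewrite !wpE; set s0 := do_op _ _.
apply: (@wp_while _ _ _ _ _ _ _ _ n
  (fun i s' => sv s' vU = i /\ forall u, u < i -> sa s' aY u = sa s aX u)) => //.
- by rewrite /loop_bound; lia.
- move=> i s1 lt_i fr [s1U s1Y].
  have s1N : sv s1 vN = n by rewrite (framed_sv fr).
  have s1X : sa s1 aX =1 sa s aX by move=> p; rewrite (framed_sa fr).
  have lt_iN : i < N by lia.
  split; first by rewrite /holds /= s1U s1N; lia.
  rewrite !wpE /holds /= s1U s1X lt_iN andbT.
  case E1: (sa s aX i); split=> //= u; rewrite ltnS leq_eqVlt => /orP[/eqP->|lt_u];
    by rewrite ?eqxx ?E1 // ltn_eqF // s1Y.
- move=> s1 fr [s1U s1Y].
  have s1N : sv s1 vN = n by rewrite (framed_sv fr).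
  by rewrite /holds /= s1U s1N eqxx; split=> //=; lia.
Qed.

Definition chk_state := ((nat -> bool) * nat * nat)%type.

Definition chk_step (g : nat -> bool) p (st : chk_state) : chk_state :=
  let: (Y, cur, bad) := st in
  let u := p %/ n in let w := p %% n in
  if [&& a p, ~~ Y u & ~~ Y w] then
    if cur == k then (Y, cur, bad.+1)
    else ((fun z => (z == (if g cur then u else w)) || Y z), cur.+1, bad)
  else st.

(* The greedy run over the first [p] cells of the adjacency matrix: the guess
   [g cur] says which endpoint of the next uncovered edge joins the cover. *)
Definition chk g (Y : nat -> bool) cur p : chk_state := iteri p (chk_step g) (Y, cur, 0).

Lemma chk_ext g g' Y cur p : g =1 g' -> chk g Y cur p = chk g' Y cur p.
Proof.
move=> e; elim: p => //= p ->; case: (chk g' Y cur p) => [[Y1 c1] b1].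
by rewrite /chk_step e.
Qed.

Definition rep_chk s (st : chk_state) :=
  [/\ sv s vCUR = st.1.2, sv s vBAD = st.2, st.1.2 <= k &
      forall z, z < n -> sa s aY z = st.1.1 z].

Lemma wp_CoverEdge g st u w s (R : store -> Prop) : u < n -> w < n ->
  sa s aADJ =1 a -> sa s aG =1 g -> sv s vK = k -> sv s vU = u -> sv s vW = w ->
  sv s vSQ = u * n + w -> rep_chk s st ->
  (forall s', framed CoverEdge s s' -> rep_chk s' (chk_step g (u * n + w) st) -> R s') ->
  wp CoverEdge s R.
Proof.
move=> lt_u lt_w sA sG sK sU sW sSQ rep HR.
suff : wp CoverEdge s (fun s' => rep_chk s' (chk_step g (u * n + w) st)).
  by move/wp_frame; apply: wp_mono => s' [? ?]; apply: HR.
case: st rep {HR} => [[Y cur] bad] [/= sC sB le_cur sY].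
have lt_SQ : u * n + w < N by nia.
have ltN z : z <= n -> z < N by lia.
rewrite /chk_step divnMDl // divn_small // addn0 modnMDl modn_small //.
rewrite !wpE /holds /= sSQ sA sU sW sC sK sG lt_SQ !ltN ?(ltnW lt_u) ?(ltnW lt_w) //; last by lia.
rewrite !andbT !sY //.
case: (a _) => //=; case EU: (Y u) => //=; case EW: (Y w) => //=.
case: eqP => [e|ne]; first by split=> //=; rewrite ?sB.
have lt_cur : cur < k by rewrite ltn_neqAle le_cur andbT; apply/eqP.
case: (g cur); split=> //= z lt_z; rewrite ?sU ?sW sY //; by case: eqP.
Qed.

Lemma wp_CoverRow g st u s (R : store -> Prop) : u < n ->
  sa s aADJ =1 a -> sa s aG =1 g -> sv s vK = k -> sv s vU = u -> sv s vN = n ->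
  sv s vSQ = u * n ->
  (forall w, chk_step g (u * n + w) (st (u * n + w)) = st (u * n + w).+1) ->
  rep_chk s (st (u * n)) ->
  (forall s', framed CoverRow s s' -> sv s' vSQ = u.+1 * n ->
     rep_chk s' (st (u.+1 * n)) -> R s') ->
  wp CoverRow s R.
Proof.
move=> lt_u sA sG sK sU sN sSQ stS rep HR.
suff : wp CoverRow s (fun s' => sv s' vSQ = u.+1 * n /\ rep_chk s' (st (u.+1 * n))).
  by move/wp_frame; apply: wp_mono => s' [[? ?] ?]; apply: HR.
rewrite !wpE; set s0 := do_op _ _.
apply: (@wp_while _ _ _ _ _ _ _ _ n
  (fun i s' => [/\ sv s' vW = i, sv s' vSQ = u * n + i & rep_chk s' (st (u * n + i))])) => //.
- by rewrite /loop_bound; lia.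
- by rewrite addn0; split.
- move=> i s1 lt_i fr [s1W s1SQ s1rep].
  have s1N : sv s1 vN = n by rewrite (framed_sv fr).
  have s1U : sv s1 vU = u by rewrite (framed_sv fr).
  have s1K : sv s1 vK = k by rewrite (framed_sv fr).
  have s1A : sa s1 aADJ =1 a by move=> p; rewrite (framed_sa fr) //= sA.
  have s1G : sa s1 aG =1 g by move=> p; rewrite (framed_sa fr) //= sG.
  split; first by rewrite /holds /= s1W s1N; lia.
  rewrite wp_seqE; apply: (wp_CoverEdge lt_u lt_i s1A s1G s1K s1U s1W s1SQ s1rep).
  move=> s2 fr2 s2rep; rewrite !wpE /= (framed_sv fr2) // (framed_sv fr2) // s1W s1SQ.
  by rewrite addnS -stS.
- move=> s1 fr [s1W s1SQ s1rep].
  have s1N : sv s1 vN = n by rewrite (framed_sv fr).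
  rewrite /holds /= s1W s1N eqxx mulSn [n + _]addnC; split=> //=; lia.
Qed.

Lemma wp_Check g X sz s (R : store -> Prop) :
  sa s aADJ =1 a -> sa s aG =1 g -> sv s vK = k -> sv s vN = n -> sv s vSZ = sz ->
  sv s vZERO = 0 -> sz <= k -> (forall u, u < n -> sa s aX u = X u) ->
  (forall s', framed Check s s' ->
     sv s' vRES = sv s vRES + ((chk g X sz (n * n)).2 == 0) -> R s') ->
  wp Check s R.
Proof.
move=> sA sG sK sN sSZ sZ le_sz sX HR.
suff : wp Check s (fun s' => sv s' vRES = sv s vRES + ((chk g X sz (n * n)).2 == 0)).
  by move/wp_frame; apply: wp_mono => s' [? ?]; apply: HR.
rewrite wp_seqE; apply: wp_CopyXY => // s1 fr1 s1Y.
rewrite !(wp_seqE, wp_doE); set s0 := do_op _ _.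
apply: (@wp_while _ _ _ _ _ _ _ _ n
  (fun i s' => [/\ sv s' vU = i, sv s' vSQ = i * n & rep_chk s' (chk g X sz (i * n))])) => //.
- by rewrite /loop_bound; lia.
- split=> //; split=> //=; first by rewrite (framed_sv fr1).
  by move=> z lt_z; rewrite s1Y ?sX.
- move=> i s2 lt_i fr [s2U s2SQ s2rep].
  have s2N : sv s2 vN = n by rewrite (framed_sv fr) //= (framed_sv fr1).
  have s2K : sv s2 vK = k by rewrite (framed_sv fr) //= (framed_sv fr1).
  have s2A : sa s2 aADJ =1 a by move=> p; rewrite (framed_sa fr) //= (framed_sa fr1) //= sA.
  have s2G : sa s2 aG =1 g by move=> p; rewrite (framed_sa fr) //= (framed_sa fr1) //= sG.
  split; first by rewrite /holds /= s2U s2N; lia.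
  rewrite wp_seqE; apply: (wp_CoverRow (st := chk g X sz) lt_i s2A s2G s2K s2U s2N s2SQ) => //.
  move=> s3 fr3 s3SQ s3rep; rewrite !wpE /= (framed_sv fr3) // s2U.
  by split.
- move=> s2 fr [s2U s2SQ [_ s2B _ _]].
  have s2N : sv s2 vN = n by rewrite (framed_sv fr) //= (framed_sv fr1).
  have s2Z : sv s2 vZERO = 0 by rewrite (framed_sv fr) //= (framed_sv fr1).
  have s2R : sv s2 vRES = sv s vRES by rewrite (framed_sv fr) //= (framed_sv fr1).
  split; first by rewrite /holds /= s2U s2N eqxx /=; lia.
  rewrite !wpE /holds /= s2B s2Z.
  case: eqP => [->|_] /=; last by rewrite s2R addn0.
  by rewrite (leq_ltn_trans _ N_big) //= s2R addn1.
Qed.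

Lemma wp_NextGuess g sz s (R : store -> Prop) : sz <= k -> sv s vSZ = sz ->
  sa s aG =1 g -> g k = false ->
  (forall s', framed NextGuess s s' ->
     bits_val (sa s' aG) sz (k - sz).+1 = (bits_val g sz (k - sz).+1).+1 ->
     (forall p, ~~ (sz <= p <= k) -> sa s' aG p = g p) -> R s') ->
  wp NextGuess s R.
Proof.
move=> le_sz sSZ sG gk HR.
suff : wp NextGuess s (fun s' =>
    bits_val (sa s' aG) sz (k - sz).+1 = (bits_val g sz (k - sz).+1).+1 /\
    (forall p, ~~ (sz <= p <= k) -> sa s' aG p = g p)).
  by move/wp_frame; apply: wp_mono => s' [[? ?] ?]; apply: HR.
(* The least such [r] is the length of the run of ones to be cleared. The overflow bit is still
   free, so the carry stops at [k] or before. *)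
have ex_r : exists r, ~~ g (sz + r) by exists (k - sz); rewrite subnKC ?gk.
case: (ex_minnP ex_r) => r /negbTE gr min_r.
have le_r : r <= k - sz by apply: min_r; rewrite subnKC ?gk.
rewrite wp_seqE wp_doE wp_seqE; set s0 := do_op _ _.
apply: (@wp_while _ _ _ _ _ _ _ _ r
  (fun i s' => [/\ sv s' vQ = sz + i,
     forall p, sz <= p < sz + i -> sa s' aG p = false &
     forall p, ~~ (sz <= p < sz + i) -> sa s' aG p = g p])) => //.
- by rewrite /loop_bound; lia.
- by rewrite /= sSZ addn0; split=> // p; lia.
- move=> i s1 lt_i fr [s1Q s1G0 s1G].
  have lt_Q : sz + i < N by lia.
  have gi : g (sz + i) by apply: contraLR lt_i => /min_r; rewrite -leqNgt.
  split; first by rewrite /holds /= s1Q s1G ?gi ?lt_Q //; lia.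
  rewrite !wpE /= s1Q addnS; split=> // p bnd_p; case: eqP => // e.
  + by apply: s1G0; lia.
  + by lia.
  + by apply: s1G; lia.
- move=> s1 fr [s1Q s1G0 s1G].
  split; first by rewrite /holds /= s1Q s1G ?gr //; lia.
  rewrite wp_doE; set s2 := do_op _ _.
  have s2G p : sa s2 aG p = (p == sz + r) || sa s1 aG p.
    by rewrite /= s1Q; case: eqP.
  split; last by move=> p bnd_p; rewrite s2G s1G; lia.
  apply: (@bits_val_next _ _ _ _ r) => //.
  + move=> i bnd_i; have -> : i = sz + (i - sz) by lia.
    by apply: contraT => /min_r; lia.
  + by move=> i bnd_i; rewrite s2G s1G0 ?orbF; lia.
  + by rewrite s2G eqxx.
  + by move=> i bnd_i; rewrite s2G s1G; lia.
Qed.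

Definition guess_ok X sz g := (chk g X sz (n * n)).2 == 0.
Definition guess_on sz g := forall p, ~~ (sz <= p < k) -> g p = false.
Definition some_guess X sz := exists2 g, guess_on sz g & guess_ok X sz g.

(** In iteration [i] the current string has value [i], and [vRES] accounts for the strings of
    smaller value. *)
Lemma wp_Enumerate X sz s (R : store -> Prop) :
  2 ^ (k - sz) <= E ->
  sa s aADJ =1 a -> sv s vK = k -> sv s vN = n -> sv s vSZ = sz ->
  sv s vZERO = 0 -> sz <= k -> (forall u, u < n -> sa s aX u = X u) ->
  (forall p, sa s aG p = false) ->
  (forall s', framed Enumerate s s' -> (forall p, sa s' aG p = false) ->
     (sv s' vRES <> 0 <-> sv s vRES <> 0 \/ some_guess X sz) -> R s') ->
  wp Enumerate s R.
Proof.
move=> leE sA sK sN sSZ sZ le_sz sX sG HR.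
suff : wp Enumerate s (fun s' => (forall p, sa s' aG p = false) /\
     (sv s' vRES <> 0 <-> sv s vRES <> 0 \/ some_guess X sz)).
  by move/wp_frame; apply: wp_mono => s' [[? ?] ?]; apply: HR.
have lt_kN : k < N by lia.
set b := k - sz in leE *.
have valE g : bits_val g sz b.+1 = bits_val g sz b + g k * 2 ^ b.
  by rewrite bits_val_last subnKC.
rewrite wp_seqE.
apply: (@wp_while _ _ _ _ _ _ _ _ (2 ^ b)
  (fun i s' => [/\ bits_val (sa s' aG) sz b.+1 = i,
     forall p, ~~ (sz <= p <= k) -> sa s' aG p = false &
     sv s' vRES <> 0 <-> sv s vRES <> 0 \/
       exists g, [/\ guess_on sz g, guess_ok X sz g & bits_val g sz b.+1 < i]])) => //.
- split=> //; first exact: bits_val0.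
  by split=> [|[//|[g [_ _]]]]; [left | lia].
- move=> i s1 lt_i fr [s1V s1G s1R].
  have s1N : sv s1 vN = n by rewrite (framed_sv fr).
  have s1K : sv s1 vK = k by rewrite (framed_sv fr).
  have s1SZ : sv s1 vSZ = sz by rewrite (framed_sv fr).
  have s1Z : sv s1 vZERO = 0 by rewrite (framed_sv fr).
  have s1A : sa s1 aADJ =1 a by move=> p; rewrite (framed_sa fr) //= sA.
  have s1X u : u < n -> sa s1 aX u = X u by move=> lt_u; rewrite (framed_sa fr) //= sX.
  have s1k : sa s1 aG k = false.
    by move: s1V; rewrite valE; case: (sa s1 aG k) => //=; lia.
  split; first by rewrite /holds /= s1K s1k.
  have s1on : guess_on sz (sa s1 aG).
    move=> p np; case: (p =P k) => [->//|ne]; apply: s1G; lia.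
  rewrite wp_seqE; apply: (@wp_Check (sa s1 aG) X sz) => // s2 fr2 s2R.
  have s2SZ : sv s2 vSZ = sz by rewrite (framed_sv fr2).
  have s2G : sa s2 aG =1 sa s1 aG by move=> p; rewrite (framed_sa fr2).
  apply: (@wp_NextGuess (sa s1 aG) sz) => // s3 fr3 s3V s3G; split.
  + by rewrite s3V s1V.
  + by move=> p np; rewrite s3G // s1G.
  rewrite (framed_sv fr3) // s2R; split.
    case E1: (_ == 0).
      by move=> _; right; exists (sa s1 aG); split=> //; rewrite s1V.
    rewrite addn0 => /s1R[?|[g [g1 g2 g3]]]; [by left | right].
    by exists g; split=> //; apply: ltnW.
  move=> H; suff [H1|H1] : sv s1 vRES <> 0 \/ guess_ok X sz (sa s1 aG).
  + by case: (sv s1 vRES) H1.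
  + by rewrite -/(guess_ok X sz (sa s1 aG)) H1 addn1.
  case: H => [?|[g [g1 g2]]]; first by left; apply/s1R; left.
  rewrite ltnS leq_eqVlt => /orP[/eqP e|lt_g]; last first.
    by left; apply/s1R; right; exists g.
  (* A string of value [i] is the current one: equal values give equal bits between [sz] and [k],
     and both strings vanish elsewhere. *)
  right; rewrite -s1V in e; rewrite /guess_ok -(@chk_ext g) // => p.
  case bnd_p: (sz <= p < k); last by rewrite g1 ?s1on ?bnd_p.
  by apply: (bits_val_inj e); lia.
- move=> s1 fr [s1V s1G s1R].
  have s1K : sv s1 vK = k by rewrite (framed_sv fr).
  have s1k : sa s1 aG k.
    by move: s1V; rewrite valE; case: (sa s1 aG k) => //=; have := bits_val_lt (sa s1 aG) sz b; lia.
  split; first by rewrite /holds /= s1K s1k lt_kN.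
  rewrite wp_doE /= s1K; split.
    move=> p; case: eqP => // ne; case bnd_p: (sz <= p <= k); last by rewrite s1G ?bnd_p.
    (* The value is now [2 ^ b] and bit [k] contributes all of it, so the lower bits are zero. *)
    have e : bits_val (sa s1 aG) sz b = bits_val (fun _ => false) sz b.
      by rewrite [RHS]bits_val0 //; move: s1V; rewrite valE s1k; lia.
    by apply: (bits_val_inj e); lia.
  rewrite s1R; split=> [[?|[g [g1 g2 _]]]|[?|[g g1 g2]]]; [by left | | by left |].
    by right; exists g.
  right; exists g; split=> //; rewrite valE g1 ?ltnn ?andbF // mul0n addn0.
  exact: bits_val_lt.
Qed.

Definition candidate_ok c :=
  [/\ h <= row_size c, row_size c <= k & some_guess (row c) (row_size c)].

Hypothesis E_big : 2 ^ (k - h) <= E.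

Lemma wp_Candidate c s (R : store -> Prop) : c <= n ->
  sa s aADJ =1 a -> sv s vN = n -> sv s vK = k -> sv s vH = h -> sv s vC = c ->
  sv s vP = c * n -> sv s vZERO = 0 -> (forall p, sa s aG p = false) ->
  (forall u, sa s aBIG u = (u < c) && (h <= row_deg u)) ->
  (forall s', framed Candidate s s' -> sv s' vP = c.+1 * n -> sv s' vC = c.+1 ->
     (forall p, sa s' aG p = false) ->
     (c < n -> forall u, sa s' aBIG u = (u < c.+1) && (h <= row_deg u)) ->
     (sv s' vRES <> 0 <-> sv s vRES <> 0 \/ candidate_ok c) -> R s') ->
  wp Candidate s R.
Proof.
move=> le_c sA sN sK sH sC sP sZ sG sB HR.
suff : wp Candidate s (fun s' => [/\ sv s' vP = c.+1 * n, sv s' vC = c.+1,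
     forall p, sa s' aG p = false,
     c < n -> forall u, sa s' aBIG u = (u < c.+1) && (h <= row_deg u) &
     sv s' vRES <> 0 <-> sv s vRES <> 0 \/ candidate_ok c]).
  by move/wp_frame; apply: wp_mono => s' [[? ? ? ? ?] ?]; apply: HR.
rewrite wp_seqE; apply: (@wp_BuildX c) => //.
  by move=> cn u lt_u; rewrite sB cn lt_u.
move=> s1 fr1 s1P s1SZ s1D s1BAD s1X.
have s1N : sv s1 vN = n by rewrite (framed_sv fr1).
have s1K : sv s1 vK = k by rewrite (framed_sv fr1).
have s1H : sv s1 vH = h by rewrite (framed_sv fr1).
have s1C : sv s1 vC = c by rewrite (framed_sv fr1).
have s1Z : sv s1 vZERO = 0 by rewrite (framed_sv fr1).
have s1R : sv s1 vRES = sv s vRES by rewrite (framed_sv fr1).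
have s1A : sa s1 aADJ =1 a by move=> p; rewrite (framed_sa fr1) //= sA.
have s1G p : sa s1 aG p = false by rewrite (framed_sa fr1).
have s1B u : sa s1 aBIG u = (u < c) && (h <= row_deg u) by rewrite (framed_sa fr1).
have degE : c < n -> (h <= row_size c) = (h <= row_deg c) by move/row_size_deg->.
have splitc u : (u < c.+1) && (h <= row_deg u) =
    (u < c) && (h <= row_deg u) || (u == c) && (h <= row_deg c).
  by rewrite ltnS leq_eqVlt; case: eqP => [->|_] //=; rewrite ?ltnn // orbF.
rewrite wp_seqE wp_ifE.
have -> : holds N (TEq vD vH) s1 = (h <= row_size c) by rewrite /holds /= s1D s1H; lia.
case: ifP => big; last first.
  rewrite !wpE /= s1C s1P s1R; split=> //.
    by move=> lt_c u; rewrite s1B splitc -degE // big andbF orbF.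
  by split=> [?|[//|[]]]; [left | rewrite big].
rewrite wp_seqE wp_doE wp_ifE; set s2 := do_op _ _.
have s2B : c < n -> forall u, sa s2 aBIG u = (u < c.+1) && (h <= row_deg u).
  move=> lt_c u; rewrite splitc /= s1C s1B -degE // big andbT.
  by case: eqP => _; rewrite ?orbT ?orbF.
have -> : holds N (TEq vBAD vZERO) s2 = (row_size c <= k).
  by rewrite /holds /= s1BAD s1Z; lia.
case: ifP => small; last first.
  rewrite !wpE /= s1C s1P s1R; split=> //.
    by move=> lt_c u; rewrite -s2B //= s1C.
  by split=> [?|[//|[]]]; [left | rewrite small].
apply: (@wp_Enumerate (row c) (row_size c)) => //.
(* Here the parameter enters: the candidate has at least [h] elements, so at most [2 ^ (k - h)]
   strings remain. *)
- by apply: leq_trans E_big; rewrite leq_exp2l //; lia.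
- by rewrite /= s1SZ; lia.
move=> s3 fr3 s3G s3R; rewrite !wpE /=.
rewrite (framed_sv fr3) //= (framed_sv fr3) //= s1P s1C; split=> //.
  by move=> lt_c u; rewrite (framed_sa fr3) // s2B.
rewrite s3R /= s1R.
by split=> -[?|H]; [by left | by right | by left | right; case: H].
Qed.

Lemma wp_Search s (R : store -> Prop) :
  sa s aADJ =1 a -> sv s vN = n -> sv s vK = k -> sv s vH = h -> sv s vC = 0 ->
  sv s vZERO = 0 -> sv s vRES = 0 -> (forall p, sa s aG p = false) ->
  (forall u, sa s aBIG u = false) ->
  (forall s', framed Search s s' ->
     (sv s' vRES <> 0 <-> exists2 c, c <= n & candidate_ok c) -> R s') ->
  wp Search s R.
Proof.
move=> sA sN sK sH sC sZ sR sG sB HR.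
suff : wp Search s (fun s' => sv s' vRES <> 0 <-> exists2 c, c <= n & candidate_ok c).
  by move/wp_frame; apply: wp_mono => s' [? ?]; apply: HR.
rewrite !(wp_seqE, wp_doE); set s0 := do_op _ _.
apply: (@wp_while _ _ _ _ _ _ _ _ n.+1
  (fun i s' => [/\ sv s' vC = i, sv s' vP = i * n, forall p, sa s' aG p = false,
     i <= n -> forall u, sa s' aBIG u = (u < i) && (h <= row_deg u) &
     sv s' vRES <> 0 <-> exists2 c, c < i & candidate_ok c])) => //.
- by rewrite /loop_bound; lia.
- by split=> //=; split=> [|[]]; rewrite ?sR.
- move=> i s1 lt_i fr [s1C s1P s1G s1B s1R].
  have s1N : sv s1 vN = n by rewrite (framed_sv fr).
  have s1J : sv s1 vJ = n.+1 by rewrite (framed_sv fr) //= sN.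
  have s1K : sv s1 vK = k by rewrite (framed_sv fr).
  have s1H : sv s1 vH = h by rewrite (framed_sv fr).
  have s1Z : sv s1 vZERO = 0 by rewrite (framed_sv fr).
  have s1A : sa s1 aADJ =1 a by move=> p; rewrite (framed_sa fr) //= sA.
  split; first by rewrite /holds /= s1C s1J; lia.
  apply: (@wp_Candidate i) => //; first exact: s1B.
  move=> s2 fr2 s2P s2C s2G s2B s2R; split=> //.
  rewrite s2R s1R; split.
    by case=> [[c lt_c cok]|cok]; [exists c => //; exact: ltnW | exists i].
  case=> c; rewrite ltnS leq_eqVlt => /orP[/eqP->|lt_c] cok; [by right | left].
  by exists c.
- move=> s1 fr [s1C s1P s1G s1B s1R].
  have s1J : sv s1 vJ = n.+1 by rewrite (framed_sv fr) //= sN.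
  by rewrite /holds /= s1C s1J eqxx n_lt.
Qed.

End Search.

(** * Correctness of the guesses *)

Lemma card_count_iota n (P : pred 'I_n) (p : pred nat) :
  (forall i : 'I_n, p i = P i) -> #|[set i | P i]| = count p (iota 0 n).
Proof.
move=> pP; rewrite -sum1_card -sum1_count -[n in iota 0 n]subn0 -/(index_iota 0 n) big_mkord.
by apply: eq_bigl => i; rewrite inE pP.
Qed.

Lemma count_add1 (p : pred nat) x n : x < n -> ~~ p x ->
  count (fun z => (z == x) || p z) (iota 0 n) = (count p (iota 0 n)).+1.
Proof.
move=> lt_x px.
have := count_predUI (pred1 x) p (iota 0 n).
rewrite (@eq_count _ (predI (pred1 x) p) pred0); last first.
  by move=> z /=; case: eqP => [->|] //=; apply: negbTE.
by rewrite count_pred0 addn0 count_uniq_mem ?iota_uniq // mem_iota add0n lt_x.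
Qed.

(** * The greedy run along the adjacency matrix *)

Section Greedy.

Variables (a : nat -> bool) (n k : nat).
Hypothesis n_gt0 : 0 < n.

Notation chk := (chk a n k).
Notation chk_step := (chk_step a n k).
Notation size_of Y := (count Y (iota 0 n)).

Lemma divn_lt_sqr p : p < n * n -> p %/ n < n.
Proof. by rewrite ltn_divLR. Qed.

Lemma chkS g X sz p : chk g X sz p.+1 = chk_step g p (chk g X sz p).
Proof. by []. Qed.

(** Each step adds an endpoint of an uncovered edge, hence a vertex outside [Y], so [cur] remains
    the exact size of [Y]. *)
Lemma chk_sound g X sz p : p <= n * n -> size_of X = sz -> sz <= k ->
  let: (Y, cur, bad) := chk g X sz p in
  [/\ size_of Y = cur, cur <= k &
      bad = 0 -> forall q, q < p -> a q -> Y (q %/ n) || Y (q %% n)].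
Proof.
move=> le_p szX le_sz; elim: p le_p => [|p IH] // lt_p.
have := IH (ltnW lt_p); rewrite chkS; case: (chk g X sz p) => [[Y cur] bad] [sY le_cur cov].
rewrite /chk_step; case: ifP => [/and3P[ap nYu nYw]|covp]; last first.
  split=> // b0 q; rewrite ltnS leq_eqVlt => /orP[/eqP->|lt_q]; last exact: cov.
  by move=> ap; apply: contraFT covp; rewrite negb_or ap.
case: eqP => [//|/eqP ne]; split.
- rewrite count_add1 ?sY //; last by case: ifP.
  by case: ifP => _; rewrite ?divn_lt_sqr // ltn_mod.
- by rewrite ltn_neqAle ne.
- move=> b0 q; rewrite ltnS leq_eqVlt => /orP[/eqP->|lt_q] aq.
    by case: ifP => _; rewrite eqxx ?orbT.
  by have /orP[->|->] := cov b0 q lt_q aq; rewrite ?orbT.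
Qed.

(** Only guess bits below [cur] have been read so far; the others may still be chosen. *)
Lemma chk_prefix g g' X sz p Y cur bad : chk g X sz p = (Y, cur, bad) ->
  (forall i, i < cur -> g' i = g i) -> chk g' X sz p = (Y, cur, bad).
Proof.
elim: p Y cur bad => [|p IH] Y cur bad //; rewrite !chkS.
case E: (chk g X sz p) => [[Y0 cur0] bad0]; rewrite {1}/chk_step.
case: ifP => [c1|c1].
  case: eqP => c2 [<- <- <-] gg'; first by rewrite (IH _ _ _ E) //= c1 c2 eqxx.
  rewrite (IH _ _ _ E) => [|i lt_i]; last by apply: gg'; apply: ltnW.
  by rewrite /chk_step c1 gg' //; case: eqP.
by case=> <- <- <- gg'; rewrite (IH _ _ _ E) // /chk_step c1.
Qed.

(** The string is built along the run: at an uncovered edge the next bit selects an endpoint in [Z].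
    The partial cover stays inside [Z], so there is room for one more vertex whenever one is called
    for. *)
Lemma chk_complete X Z sz : size_of X = sz -> size_of Z <= k ->
  (forall u, u < n -> X u -> Z u) ->
  (forall q, q < n * n -> a q -> Z (q %/ n) || Z (q %% n)) ->
  some_guess a n k X sz.
Proof.
move=> szX leZ XZ covZ.
have le_sub (Y : pred nat) : (forall u, u < n -> Y u -> Z u) -> size_of Y <= size_of Z.
  move=> YZ; rewrite -!size_filter uniq_leq_size ?filter_uniq ?iota_uniq // => u.
  rewrite !mem_filter mem_iota => /andP[Yu /andP[_ lt_u]].
  by rewrite YZ // mem_iota.
suff H p : p <= n * n -> exists g Y cur, [/\ chk g X sz p = (Y, cur, 0),
    forall i, ~~ (sz <= i < cur) -> g i = false, sz <= cur, size_of Y = cur &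
    forall u, u < n -> Y u -> Z u].
  have [g [Y [cur [e g0 _ szY YZ]]]] := H _ (leqnn _).
  exists g; last by rewrite /guess_ok e.
  move=> i np; apply: g0; apply: contra np => /andP[-> lt_i] /=.
  by apply: leq_trans lt_i _; rewrite -szY (leq_trans (le_sub Y YZ)).
elim: p => [|p IH] le_p; first by exists (fun=> false), X, sz.
have [g [Y [cur [e g0 le_cur szY YZ]]]] := IH (ltnW le_p).
case c1: [&& a p, ~~ Y (p %/ n) & ~~ Y (p %% n)]; last first.
  by exists g, Y, cur; split=> //; rewrite chkS e /chk_step c1.
have /and3P[ap nYu nYw] := c1.
pose x := if Z (p %/ n) then p %/ n else p %% n.
have lt_x : x < n by rewrite /x; case: ifP => _; rewrite ?divn_lt_sqr // ltn_mod.
have nYx : ~~ Y x by rewrite /x; case: ifP.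
have Zx : Z x by rewrite /x; have := covZ p le_p ap; case: ifP.
have xYZ : forall u, u < n -> (u == x) || Y u -> Z u.
  by move=> u lt_u /orP[/eqP->|]; last exact: YZ.
have lt_cur : cur < k.
  by rewrite -szY -(count_add1 lt_x nYx) (leq_trans (le_sub _ xYZ)).
pose g' i := if i == cur then Z (p %/ n) else g i.
exists g', (fun z => (z == x) || Y z), cur.+1; split=> //.
- rewrite chkS (@chk_prefix g g' _ _ _ _ _ _ e); last first.
    by move=> i lt_i; rewrite /g' ltn_eqF.
  by rewrite /chk_step c1 ltn_eqF // /g' eqxx.
- move=> i np; rewrite /g'; case: eqP => [ei|ne]; first by move: np; lia.
  by apply: g0; lia.
- exact: leqW.
- by rewrite count_add1 ?szY.
Qed.

End Greedy.

(** * The h-index, candidate sets and vertex covers *)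

Section Graph.

Variables (n : nat) (e : rel 'I_n) (a : nat -> bool).
Hypothesis n_gt0 : 0 < n.
Hypothesis aE : forall i j : 'I_n, a (i * n + j) = e i j.

Lemma row_degE (v : 'I_n) : row_deg a n v = degree e v.
Proof.
rewrite /degree (@card_count_iota _ _ (fun u => a (v * n + u))) => [|u]; last exact: aE.
by rewrite /row_deg -[in LHS](addn0 (v * n)) iotaDl count_map.
Qed.

Lemma num_largeE j : num_large a n j = #|[set v | j <= degree e v]|.
Proof.
by rewrite (@card_count_iota _ _ (fun v => j <= row_deg a n v)) // => v; rewrite row_degE.
Qed.

(** The maximum is attained, as 0 satisfies the condition, and lowering j relaxes both the required
    number and the required degree. *)
Lemma hindex_le j : j <= hindex e -> j <= num_large a n j.
Proof.
rewrite num_largeE /hindex => le_j.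
have [|i i_ok maxE] := @eq_bigmax_cond _
    [pred i : 'I_n.+1 | i <= #|[set v | i <= degree e v]|] (@nat_of_ord n.+1).
  by apply/card_gt0P; exists ord0; rewrite inE.
rewrite maxE in le_j; rewrite inE in i_ok.
apply: (leq_trans le_j (leq_trans i_ok _)).
by apply: subset_leq_card; apply/subsetP => v; rewrite !inE; exact: leq_trans le_j.
Qed.

(** Otherwise [(hindex e).+1] would contradict maximality. Beyond the range of the maximum the bound
    holds since there are only [n] vertices. *)
Lemma hindex_gt : num_large a n (hindex e).+1 <= hindex e.
Proof.
rewrite num_largeE; case: (leqP (hindex e).+1 n) => [lt_h|]; last first.
  by rewrite ltnS; apply: leq_trans; rewrite -[X in _ <= X](card_ord n) max_card.
rewrite leqNgt; apply/negP => big.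
have := @leq_bigmax_cond _ (fun i : 'I_n.+1 => i <= #|[set v | i <= degree e v]|)
   (@nat_of_ord n.+1) (Ordinal (lt_h : (hindex e).+1 < n.+1)) big.
by rewrite /= -/(hindex e) ltnn.
Qed.

Lemma has_vc_min k : has_vc_at_most e k <-> has_vc_at_most e (minn n k).
Proof.
split=> -[X [vcX le_X]]; exists X; split=> //.
  by rewrite leq_min le_X andbT -[X in _ <= X](card_ord n) max_card.
by apply: leq_trans le_X (geq_minr _ _).
Qed.

Lemma cell_pair q : q < n * n -> exists i j : 'I_n,
  [/\ q %/ n = i, q %% n = j & a q = e i j].
Proof.
move=> lt_q; have lt_i : q %/ n < n by apply: divn_lt_sqr.
have lt_j : q %% n < n by rewrite ltn_mod.
by exists (Ordinal lt_i), (Ordinal lt_j); split=> //; rewrite -aE /= -divn_eq.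
Qed.

(** Whatever set the run starts from, finishing without a failure means that every edge is covered
    within the budget. *)
Lemma candidate_vc k c : candidate_ok a n k (hindex e) c -> has_vc_at_most e k.
Proof.
case=> _ le_k [g _]; rewrite /guess_ok.
have := @chk_sound a n k n_gt0 g (row a n (hindex e) c) _ _ (leqnn _) erefl le_k.
case: (chk _ _ _ _ _ _ _) => [[Y cur] bad] [szY le_cur cov] /= /eqP bad0.
exists [set i : 'I_n | Y i]; split; last by rewrite (@card_count_iota _ _ Y) // szY.
move=> u v euv; apply/orP; rewrite !inE.
have lt_q : u * n + v < n * n by have := ltn_ord u; have := ltn_ord v; nia.
have := cov bad0 _ lt_q; rewrite aE euv => /(_ isT).
by rewrite divnMDl // divn_small // addn0 modnMDl modn_small.
Qed.

Lemma vc_candidate k : has_vc_at_most e k ->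
  exists2 c, c <= n & candidate_ok a n k (hindex e) c.
Proof.
case=> Z [vcZ le_Z]; set h := hindex e.
pose z u := if insub u is Some i then i \in Z else false.
have zE (i : 'I_n) : z i = (i \in Z) by rewrite /z valK.
have sz_z : count z (iota 0 n) = #|Z|.
  by rewrite -(@card_count_iota _ (fun i => i \in Z) z) // cardsE.
have cov q : q < n * n -> a q -> z (q %/ n) || z (q %% n).
  move=> /cell_pair[i [j [-> -> ->]]] /vcZ; rewrite !zE; by case=> ->; rewrite ?orbT.
have candidate c : c <= n -> h <= row_size a n h c ->
    (forall u : 'I_n, row a n h c u -> u \in Z) -> candidate_ok a n k h c.
  move=> le_c big sub; have subz u : u < n -> row a n h c u -> z u.
    by move=> lt_u; rewrite -[u]/(val (Ordinal lt_u)) zE; apply: sub.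
  split=> //; last by apply: (@chk_complete _ _ _ n_gt0 _ z) => //; rewrite sz_z.
  apply: leq_trans le_Z; rewrite -sz_z /row_size -!size_filter.
  rewrite uniq_leq_size ?filter_uniq ?iota_uniq // => u.
  by rewrite !mem_filter mem_iota => /andP[ru /andP[_ lt_u]]; rewrite subz // mem_iota.
case: (boolP [exists v, (h <= degree e v) && (v \notin Z)]) => [/existsP[v /andP[big vZ]]|].
  exists v; first exact: ltnW.
  apply: candidate; first exact: ltnW.
    by rewrite row_size_deg // row_degE.
  move=> u; rewrite /row ltn_eqF // aE => /vcZ[]; first by rewrite (negbTE vZ).
  by [].
rewrite negb_exists => /forallP noZ; exists n => //; apply: candidate => //.
  apply: leq_trans (hindex_le (leqnn _)) _.
  by rewrite /row_size (@eq_count _ _ (fun v => h <= row_deg a n v)) // => v; rewrite /row eqxx.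
move=> u; rewrite /row eqxx row_degE => big.
by have := noZ u; rewrite big negbK.
Qed.

Lemma has_vc_candidate k : has_vc_at_most e k <->
  exists2 c, c <= n & candidate_ok a n (minn n k) (hindex e) c.
Proof.
rewrite has_vc_min; split; first exact: vc_candidate.
by case=> c _ /candidate_vc.
Qed.

End Graph.

Definition Main := FindN;; ReadK;; FindH;; Search.

Lemma wp_Main N E n k a bs s (R : store -> Prop) h : 0 < n ->
  sv s vM = n * n -> sv s vEND = (n * n).+1 + size bs -> sv s vEND < N ->
  (forall x, 1 < x -> sv s x = 0) ->
  sa s aADJ =1 a -> (forall x, 0 < x -> forall p, sa s x p = false) ->
  (forall i, i < size bs -> a ((n * n).+1 + i) = nth false bs i) -> valb bs = k ->
  (forall j, j <= h -> j <= num_large a n j) -> num_large a n h.+1 <= h ->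
  2 ^ (k - h) <= E ->
  (forall s', sv s' vZERO = 0 ->
    (sv s' vRES <> 0 <-> exists2 c, c <= n & candidate_ok a n (minn n k) h c) -> R s') ->
  wp N E Main s R.
Proof.
move=> n0 sM sE ltE s0 sA a0 abs vbs hle hgt leE HR.
have N_big : (n * n).+1 < N by lia.
rewrite wp_seqE; apply: (@wp_FindN _ _ n) => //; rewrite ?s0 //; first by lia.
move=> s1 fr1 s1N.
have s1v x : x \notin mods op_vmods FindN -> 1 < x -> sv s1 x = 0.
  by move=> nx gt_x; rewrite (framed_sv fr1) ?s0.
rewrite wp_seqE; apply: (@wp_ReadK _ _ n bs) => //; try exact: s1v; rewrite ?(framed_sv fr1) //.
- exact: ltnW.
- by move=> i lt_i; rewrite (framed_sa fr1) // sA abs.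
rewrite vbs => s2 fr2 s2K.
have s2N : sv s2 vN = n by rewrite (framed_sv fr2).
have s2A : sa s2 aADJ =1 a.
  by move=> p; rewrite (framed_sa fr2) // (framed_sa fr1) // sA.
have s2v x : x \notin mods op_vmods FindN -> x \notin mods op_vmods ReadK ->
    1 < x -> sv s2 x = 0.
  by move=> n1 n2 gt_x; rewrite (framed_sv fr2) ?s1v.
rewrite wp_seqE; apply: (@wp_FindH _ _ a n n0 N_big h hle hgt) => //; try exact: s2v.
move=> s3 fr3 s3H.
have s3v x : x \notin mods op_vmods FindN -> x \notin mods op_vmods ReadK ->
    x \notin mods op_vmods FindH -> 1 < x -> sv s3 x = 0.
  by move=> n1 n2 n3 gt_x; rewrite (framed_sv fr3) // s2v.
have s3a x p : x \notin mods op_amods FindN -> x \notin mods op_amods ReadK ->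
    x \notin mods op_amods FindH -> sa s3 x p = sa s x p.
  by move=> n1 n2 n3; rewrite (framed_sa fr3) // (framed_sa fr2) // (framed_sa fr1).
have h_n : h <= n by apply: (@h_le_n a).
apply: (@wp_Search _ _ a n (minn n k) h) => //.
- exact: geq_minl.
(* Capping [k] at [n] can only decrease the number of strings. *)
- by apply: leq_trans leE; rewrite leq_exp2l // leq_sub2r ?geq_minr.
- by move=> p; rewrite s3a ?sA.
- by rewrite (framed_sv fr3).
- by rewrite (framed_sv fr3).
- by rewrite s3v.
- by rewrite s3v.
- by rewrite s3v.
- by move=> p; rewrite s3a ?a0.
- by move=> p; rewrite s3a ?a0.
- move=> s4 fr4 s4R; apply: HR => //; by rewrite (framed_sv fr4) // s3v.
Qed.

(** * A machine computing powers of two *)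

Lemma rcons_nseq (T : Type) n (x : T) : rcons (nseq n x) x = nseq n.+1 x.
Proof. by elim: n => //= n ->. Qed.

Section PowerOfTwo.

Notation state := ('I_3 + 'I_10)%type.
Notation symb := ('I_4 + unit)%type.

Let bl : symb := raw _ 0.
Let sx : symb := raw _ 1.
Let one : symb := raw _ 2.
Let sep : symb := raw _ 3.
Let sy : symb := inr tt.

Let st (i : nat) : state := inr (inord i).

Definition symb_num (a : symb) : nat := if a is inl i then i else 4.

(* On a tape [x^b 1^a # 1^m] each round turns one input [1] into [x] and doubles
   the block after [#]: every [1] there becomes [y] and a [y] is appended. *)
Definition pow2_table (q a : nat) : state * symb * dir :=
  match q, a with
  | 0, 2 => (st 0, one, DRight)
  | 0, 0 => (st 1, sep, DRight)
  | 1, 0 => (st 2, one, DRight)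
  | 2, 0 => (st 3, one, DLeft)
  | 3, 2 => (st 3, one, DLeft)
  | 3, 3 => (st 3, sep, DLeft)
  | 3, 1 => (st 4, sx, DRight)
  | 4, 2 => (st 5, sx, DRight)
  | 4, 3 => (acc _, sep, DRight)
  | 5, 2 => (st 5, one, DRight)
  | 5, 3 => (st 6, sep, DRight)
  | 6, 4 => (st 6, sy, DRight)
  | 6, 2 => (st 7, sy, DRight)
  | 6, 0 => (st 9, bl, DLeft)
  | 7, 2 => (st 7, one, DRight)
  | 7, 4 => (st 7, sy, DRight)
  | 7, 0 => (st 8, sy, DLeft)
  | 8, 2 => (st 8, one, DLeft)
  | 8, 4 => (st 8, sy, DLeft)
  | 8, 3 => (st 6, sep, DRight)
  | 9, 4 => (st 9, one, DLeft)
  | 9, 3 => (st 3, sep, DLeft)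
  | _, _ => (rej _, bl, DStay)
  end.

(** The first input symbol becomes [x], which marks the left end, and is paid for by an initial
    block of two: 2 * 2^a = 2^(a + 1). On empty input the single [1] written is the result. *)
Definition pow2_delta (q : state) (a : symb) : state * symb * dir :=
  match q with
  | inl _ => if symb_num a == 2 then (st 0, sx, DRight) else (acc _, one, DStay)
  | inr q => pow2_table q (symb_num a)
  end.

Notation prun := (arun pow2_delta).

(** Computability asks for no time bound, so step counts are hidden. *)
Definition leads (c c' : state * seq symb * seq symb) := exists t, prun t c = c'.

Lemma leads_refl c : leads c c.
Proof. by exists 0. Qed.

Lemma leads_trans c1 c2 c3 : leads c1 c2 -> leads c2 c3 -> leads c1 c3.
Proof. by move=> [t1 e1] [t2 e2]; exists (t1 + t2); rewrite arunD e1 e2. Qed.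

Lemma leads_step c c' : leads (astep pow2_delta c) c' -> leads c c'.
Proof. by case=> t e; exists t.+1; rewrite arunS. Qed.

Lemma deltaE j a : j < 10 -> pow2_delta (st j) a = pow2_table j (symb_num a).
Proof. by move=> lt_j; rewrite /= inordK. Qed.

Lemma raw_num i : i < 4 -> symb_num (raw _ i) = i.
Proof. by move=> lt_i; rewrite /= inordK. Qed.

Definition numE := (raw_num (isT : 0 < 4), raw_num (isT : 1 < 4),
                    raw_num (isT : 2 < 4), raw_num (isT : 3 < 4)).

Lemma leads_right q l u r : {in u, forall a, pow2_delta (inr q) a = (inr q, a, DRight)} ->
  leads (inr q, l, u ++ r) (inr q, rev u ++ l, r).
Proof.
elim: u l => [|a u IH] l qa; first exact: leads_refl.
apply: leads_step; rewrite rev_cons cat_rcons.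
rewrite /astep /= -/(pow2_delta (inr q) a) qa ?mem_head //; apply: IH => b b_u; apply: qa.
by rewrite inE b_u orbT.
Qed.

Lemma leads_left (f : symb -> symb) q l z c u r :
  {in c :: u, forall a, pow2_delta (inr q) a = (inr q, f a, DLeft)} ->
  leads (inr q, u ++ z :: l, c :: r) (inr q, l, z :: rev (map f (c :: u)) ++ r).
Proof.
elim: u c r => [|b u IH] c r qa.
  apply: leads_step; rewrite /astep /= -/(pow2_delta (inr q) c) qa ?mem_head //.
  exact: leads_refl.
apply: leads_step; rewrite /astep /= -/(pow2_delta (inr q) c) qa ?mem_head //.
rewrite rev_cons cat_rcons; apply: IH => d d_u; apply: qa.
by rewrite inE d_u orbT.
Qed.

Lemma in_nseq2 (P : symb -> Prop) i j a b : P a -> P b -> {in nseq i a ++ nseq j b, forall c, P c}.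
Proof.
by move=> Pa Pb c; rewrite mem_cat !mem_nseq => /orP[]/andP[_ /eqP->].
Qed.

(** [i] symbols are already doubled: they have become the leading [y], and as many [y] have been
    appended at the end. *)
Lemma leads_double i r j l :
  leads (st 6, sep :: l, nseq i sy ++ nseq r one ++ nseq i sy ++ nseq j bl)
        (st 6, nseq (2 * (i + r)) sy ++ sep :: l, nseq (j - r) bl).
Proof.
elim: r i j => [|r IH] i j.
  rewrite addn0 subn0 cat0s catA -nseqD.
  apply: (@leads_trans _ _ _ (@leads_right (inord 6) _ _ _ _)).
    by move=> a; rewrite mem_nseq => /andP[_ /eqP->]; rewrite deltaE.
  by rewrite rev_nseq mul2n addnn; exact: leads_refl.
apply: (@leads_trans _ _ _ (@leads_right (inord 6) _ _ _ _)).
  by move=> a; rewrite mem_nseq => /andP[_ /eqP->]; rewrite deltaE.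
rewrite rev_nseq.
have s1 : leads (st 6, nseq i sy ++ sep :: l, one :: nseq r one ++ nseq i sy ++ nseq j bl)
   (st 7, sy :: nseq i sy ++ sep :: l, (nseq r one ++ nseq i sy) ++ nseq j bl).
  exists 1; rewrite /arun /= !inordK //= -catA //.
apply: leads_trans s1 _.
apply: (@leads_trans _ _ _ (@leads_right (inord 7) _ _ _ _)).
  by apply: in_nseq2; rewrite deltaE // ?numE.
rewrite rev_cat !rev_nseq.
set U := nseq i sy ++ nseq r one ++ sy :: nseq i sy.
have -> : (nseq i sy ++ nseq r one) ++ sy :: nseq i sy ++ sep :: l = U ++ sep :: l.
  by rewrite /U -!catA.
have revU : rev U = nseq i.+1 sy ++ nseq r one ++ nseq i sy.
  by rewrite /U !rev_cat rev_cons !rev_nseq rcons_nseq -catA.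
have inU : {in U, forall a, pow2_delta (st 8) a = (st 8, a, DLeft)}.
  move=> a; rewrite !(mem_cat, inE, mem_nseq) => /or4P[/andP[_]|/andP[_]||/andP[_]] /eqP->;
    by rewrite deltaE // ?numE.
have U_neq0 : U <> [::] by rewrite /U; case: (i); case: (r).
clearbody U; case: U U_neq0 revU inU => // c u _ revU inU.
have s2 : leads (st 7, (c :: u) ++ sep :: l, nseq j bl)
                (st 8, u ++ sep :: l, c :: sy :: nseq j.-1 bl).
  by exists 1; case: (j) => [|j']; rewrite /arun /= !inordK.
apply: leads_trans s2 _.
apply: (@leads_trans _ _ _ (@leads_left id (inord 8) _ _ _ _ _ inU)).
rewrite map_id revU.
have s3 w : leads (st 8, l, sep :: w) (st 6, sep :: l, w).
  by exists 1; rewrite /arun /= !inordK.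
apply: leads_trans (s3 _) _.
have := IH i.+1 j.-1; rewrite addSnnS.
have -> : j.-1 - r = j - r.+1 by lia.
by rewrite -!catA -[nseq i sy ++ sy :: _]cat_rcons rcons_nseq.
Qed.

Lemma leads_round b a m j :
  exists j', leads
    (st 4, nseq b sx, nseq a.+1 one ++ sep :: nseq m one ++ nseq j bl)
    (st 4, nseq b.+1 sx, nseq a one ++ sep :: nseq (2 * m) one ++ nseq j' bl).
Proof.
exists (maxn (j - m) 1).
have s1 w : leads (st 4, nseq b sx, one :: w) (st 5, nseq b.+1 sx, w).
  by exists 1; rewrite /arun /= !inordK.
apply: leads_trans (s1 _) _.
apply: (@leads_trans _ _ _ (@leads_right (inord 5) _ _ _ _)).
  by move=> c; rewrite mem_nseq => /andP[_ /eqP->]; rewrite deltaE // numE.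
rewrite rev_nseq.
have s2 L w : leads (st 5, L, sep :: w) (st 6, sep :: L, w).
  by exists 1; rewrite /arun /= !inordK.
apply: leads_trans (s2 _ _) _.
set L := nseq a one ++ nseq b.+1 sx.
apply: leads_trans (@leads_double 0 m j L) _; rewrite add0n.
set j1 := j - m.
have s3 c w : leads (st 6, c :: w, nseq j1 bl) (st 9, w, c :: nseq (maxn j1 1) bl).
  by exists 1; case: (j1) => [|j']; rewrite /arun /= !inordK //= maxnE subSS sub0n addn0.
have s4 w : leads (st 9, L, sep :: w) (st 4, nseq b.+1 sx, nseq a one ++ sep :: w).
  (* Left of the separator stands a remaining [1], or an [x] if none is left; [head sx L] covers
     both. *)
  have s5 : leads (st 9, L, sep :: w) (st 3, behead L, head sx L :: sep :: w).
    by exists 1; rewrite /L; case: (a) => [|a']; rewrite /arun /= !inordK.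
  have s6 w' : leads (st 3, nseq b sx, sx :: w') (st 4, nseq b.+1 sx, w').
    by exists 1; rewrite /arun /= !inordK.
  apply: leads_trans s5 _; rewrite /L; case: (a) => [|a'] /=; first exact: s6.
  apply: (@leads_trans _ _ _ (@leads_left id (inord 3) _ _ _ _ _ _)).
    by move=> c; rewrite -[one :: _]/(nseq a'.+1 one) mem_nseq => /andP[_ /eqP->]; rewrite deltaE // numE.
  by rewrite map_id -[one :: nseq a' one]/(nseq a'.+1 one) rev_nseq; exact: s6.
(* For an empty block the head meets the separator at once; otherwise it first turns each [y] back
   into [1]. *)
case: m => [|m] in j1 s3 *.
  by apply: leads_trans (s3 _ _) _; exact: s4.
have -> : 2 * m.+1 = (2 * m).+2 by lia.
apply: leads_trans (s3 _ _) _.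
apply: (@leads_trans _ _ _ (@leads_left (fun=> one) (inord 9) _ _ sy (nseq (2 * m).+1 sy) _ _)).
  by move=> c; rewrite -[sy :: _]/(nseq (2 * m).+2 sy) mem_nseq => /andP[_ /eqP->]; rewrite deltaE.
rewrite -[sy :: _]/(nseq (2 * m).+2 sy) map_nseq rev_nseq; exact: s4.
Qed.

Lemma leads_pow2 b a m j : exists l j', leads
    (st 4, nseq b sx, nseq a one ++ sep :: nseq m one ++ nseq j bl)
    (acc _, l, nseq (m * 2 ^ a) one ++ nseq j' bl).
Proof.
elim: a b m j => [|a IH] b m j.
  exists (sep :: nseq b sx), j; rewrite muln1; exists 1; by rewrite /arun /= !inordK.
have [j1 s1] := leads_round b a m j.
have [l [j2 s2]] := IH b.+1 (2 * m) j1.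
by exists l, j2; rewrite expnS mulnA [m * 2]mulnC; apply: leads_trans s1 s2.
Qed.

Lemma leads_start a : exists l j', leads
    (inl ord0, [::], nseq a one) (acc _, l, nseq (2 ^ a) one ++ nseq j' bl).
Proof.
have nh := @not_halting_start 'I_10.
case: a => [|a]; first by exists [::], 0; exists 1; rewrite /arun /= nh inordK.
have s1 : leads (inl ord0, [::], nseq a.+1 one) (st 0, [:: sx], nseq a one).
  by exists 1; rewrite /arun /= nh inordK.
have s2 : leads (st 0, [:: sx], nseq a one) (st 0, nseq a one ++ [:: sx], [::]).
  rewrite -[nseq a one in X in leads X _]cats0 -[nseq a one in X in leads _ X]rev_nseq.
  apply: leads_right => c; rewrite mem_nseq => /andP[_ /eqP->].
  by rewrite deltaE // numE.
have s3 : leads (st 0, nseq a one ++ [:: sx], [::])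
                (st 3, [:: sep] ++ nseq a one ++ [:: sx], [:: one; one]).
  by exists 3; rewrite /arun /= !inordK //= !inordK //= !inordK.
have s4 : leads (st 3, [:: sep] ++ nseq a one ++ [:: sx], [:: one; one])
                (st 3, [::], sx :: rev (one :: sep :: nseq a one) ++ [:: one]).
  rewrite catA -[one :: sep :: _]map_id; apply: leads_left => c.
  by rewrite !inE mem_nseq => /or3P[|| /andP[_]] /eqP->; rewrite deltaE // ?numE.
have s5 w : leads (st 3, [::], sx :: w) (st 4, nseq 1 sx, w).
  by exists 1; rewrite /arun /= !inordK.
have [l [j s6]] := leads_pow2 1 a 2 0.
exists l, j; rewrite expnS; apply: leads_trans s6.
apply: leads_trans s1 _; apply: leads_trans s2 _; apply: leads_trans s3 _.
apply: leads_trans s4 _; apply: leads_trans (s5 _) _.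
by rewrite !rev_cons rev_nseq -!cats1 -!catA; exact: leads_refl.
Qed.

End PowerOfTwo.

Lemma computable_pow2 : computable (fun l => 2 ^ l).
Proof.
exists (machine pow2_delta) => n.
have [l [j [t run_t]]] := leads_start n.
exists t; rewrite init_code /ainit map_nseq [X in raw _ X.+1]inordK // run_code run_t.
split; first exact: code_acc.
exists (nseq j (blank (machine pow2_delta))); split; last exact: all_pred1_nseq.
rewrite map_cat !map_nseq (code_blank pow2_delta) (code_raw pow2_delta) //.
by rewrite /embed inordK.
Qed.

(** * The decision procedure *)

Lemma nth_allpairs (S T U : Type) (f : S -> T -> U) x0 y0 z0 (s : seq S) (t : seq T) i j :
  i < size s -> j < size t ->
  nth z0 [seq f x y | x <- s, y <- t] (i * size t + j) = f (nth x0 s i) (nth y0 t j).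
Proof.
move=> + lt_j; elim: s i => [|x s IH] [|i] //= lt_i; rewrite nth_cat size_map.
  by rewrite lt_j (nth_map y0).
by rewrite mulSn -addnA ltnNge leq_addr /= addKn IH.
Qed.

Definition mat n (e : rel 'I_n) : seq 'I_3 :=
  [seq (if e i j then sym1 else sym0) | i <- enum 'I_n, j <- enum 'I_n].

Lemma size_mat n (e : rel 'I_n) : size (mat e) = n * n.
Proof. by rewrite size_allpairs size_enum_ord. Qed.

Lemma nth_mat n (e : rel 'I_n) z0 (i j : 'I_n) :
  nth z0 (mat e) (i * n + j) = if e i j then sym1 else sym0.
Proof.
have := @nth_allpairs _ _ _ (fun i j => if e i j then sym1 else sym0) i i z0
  (enum 'I_n) (enum 'I_n) i j.
by rewrite size_enum_ord !ltn_ord !nth_ord_enum => ->.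
Qed.

Lemma sym0_neqH : sym0 != symH.
Proof. by rewrite -val_eqE /= !inordK. Qed.
Lemma sym1_neqH : sym1 != symH.
Proof. by rewrite -val_eqE /= !inordK. Qed.
Lemma sym0_neq1 : sym0 != sym1.
Proof. by rewrite -val_eqE /= !inordK. Qed.

Lemma all_mat n (e : rel 'I_n) : all (predC1 symH) (mat e).
Proof.
apply/allP => x /allpairsP[p [_ _ ->]].
by case: ifP => _ /=; rewrite ?sym0_neqH ?sym1_neqH.
Qed.

Lemma all_binn m k : all (predC1 symH) (Defs.binn m k).
Proof.
elim: m k => [|m IH] [|k] //=; rewrite IH andbT.
by case: ifP => _; rewrite ?sym0_neqH ?sym1_neqH.
Qed.

Lemma valb_binn m k : k <= m -> valb (map (pred1 sym1) (Defs.binn m k)) = k.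
Proof.
elim: m k => [|m IH] [|k] //= le_k; rewrite IH; last by lia.
by case E1: (odd k); rewrite /= ?eqxx ?(negbTE sym0_neq1); lia.
Qed.

Lemma nth_sep (u v : seq 'I_3) p : all (predC1 symH) u -> all (predC1 symH) v ->
  p < size (u ++ symH :: v) -> (nth symH (u ++ symH :: v) p == symH) = (p == size u).
Proof.
move=> /allP au /allP av; rewrite size_cat /= nth_cat => lt_p.
case: (ltngtP p (size u)) => [lt_u|gt_u|->]; last by rewrite subnn eqxx.
  by apply/negbTE/au/mem_nth.
have -> : p - size u = (p - (size u).+1).+1 by lia.
have lt_v : p - (size u).+1 < size v by lia.
by apply/negbTE/av/mem_nth.
Qed.

Definition main_prog := compile Main 0 (csize Main).
Definition main_TM := machine (@sweep_delta 20 4 main_prog (vRES, vZERO)).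

Lemma main_prog_ok : all (instr_ok 20 4 main_prog) main_prog.
Proof. by vm_compute. Qed.

Lemma size_main_prog : size main_prog = csize Main.
Proof. exact: size_compile. Qed.

(** For L >= 2 the summands come from W + 2 <= L^(W + 2), from (L + 1)^d <= L^(2 * d), and from 2 *
    L + 3 <= L^3, the last factor being the cost of one sweep. *)
Definition main_exp := (weight Main).+2 + 2 * loop_depth false Main + 3.

Lemma main_time L E t : 1 < L -> 0 < E -> t <= bnd L.+1 E Main ->
  (2 * L).+1 + t.+1 * (2 * L.+1).+1 <= E * L ^ main_exp.
Proof.
move=> L_gt1 E_gt0 le_t.
have := @bnd_le L.+1 E Main isT E_gt0.
(* The enumeration of guesses is the only loop of exponential length, so [E] occurs to the first
   power. *)
have -> : loop_depth true Main = 1 by [].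
rewrite expn1 /main_exp; set W := weight Main; set d := loop_depth false Main => le_bnd.
have leL : L.+1 ^ d <= L ^ (2 * d).
  by rewrite expnM; case: (d) => // d'; rewrite leq_exp2r //; nia.
set B := L ^ (2 * d) * E.
have B_gt0 : 0 < B by rewrite muln_gt0 expn_gt0 E_gt0; lia.
have le_tB : t.+2 <= W.+2 * B.
  have: bnd L.+1 E Main <= W * B by apply: leq_trans le_bnd _; rewrite leq_mul2l leq_mul2r leL !orbT.
  by move: le_t; clearbody B W; nia.
have le_L3 : 2 * L + 3 <= L ^ 3 by rewrite !expnS expn0; nia.
apply: (@leq_trans (t.+2 * (2 * L + 3))); first by lia.
apply: (@leq_trans (W.+2 * B * L ^ 3)); first by rewrite leq_mul.
have le_W : W.+2 <= L ^ W.+2 by rewrite ltnW // ltn_expl.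
have -> : E * L ^ (W.+2 + 2 * d + 3) = L ^ W.+2 * B * L ^ 3.
  by rewrite !expnD /B; lia.
by rewrite leq_mul2r leq_mul2r le_W !orbT.
Qed.

(* Vertex Cover above h-index is FPT: a computable f, a Turing machine M and
   a constant c such that on every instance (G, k) M decides whether G has a
   vertex cover of size <= k within f(k - h(G)) * |I|^c steps. *)
Theorem theorem1 :
  exists f : nat -> nat, computable f /\
  exists (M : TM) (c : nat),
    forall (n : nat) (e : rel 'I_n), symmetric e -> irreflexive e ->
    forall k : nat,
      decides_within M (enc_vc e k)
        (f (k - hindex e) * size (enc_vc e k) ^ c)
        (has_vc_at_most e k).
Proof.
exists (fun l => 2 ^ l); split; first exact: computable_pow2.
exists main_TM, main_exp => n e _ _ k.
set w := enc_vc e k; set E := 2 ^ (k - hindex e).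
have E_gt0 : 0 < E by rewrite expn_gt0.
have wE : w = mat e ++ symH :: bin k by [].
have sz_w : size w = (n * n).+1 + size (bin k).
  by rewrite wE size_cat size_mat /= addSnnS.
(* Without vertices the input begins with the separator, and the empty cover serves for every
   [k]. *)
case: (posnP n) => [n0|n_gt0].
  have -> : w = symH :: bin k by rewrite wE (size0nil (_ : size (mat e) = 0)) // size_mat n0.
  apply: decides_head_sep; first by rewrite muln_gt0 E_gt0 expn_gt0.
  exists set0; split; last by rewrite cards0.
  by move=> u; have := ltn_ord u; rewrite {2}n0.
pose a p := nth symH w p == sym1.
have aE (i j : 'I_n) : a (i * n + j) = e i j.
  have lt_p : i * n + j < n * n by have := ltn_ord i; have := ltn_ord j; nia.
  rewrite /a wE nth_cat size_mat lt_p nth_mat.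
  by case: (e i j); rewrite ?eqxx // (negbTE sym0_neq1).
pose bs := map (pred1 sym1) (bin k).
have valk : valb bs = k by apply: valb_binn.
have m_bnd : 0 < n * n < size w by rewrite muln_gt0 n_gt0 sz_w; lia.
have mP p : p < size w -> (nth symH w p == symH) = (p == n * n).
  by move=> lt_p; rewrite -(size_mat e) wE nth_sep ?all_mat ?all_binn // -wE.
have wpM : wp (size w).+1 E Main (load_store w (n * n)) (fun s => sv s vZERO = 0 /\
    (sv s vRES <> 0 <-> has_vc_at_most e k)).
  apply: (@wp_Main _ _ n k a bs _ _ (hindex e)) => //.
  - by rewrite /= sz_w size_map.
  - by move=> [|[|x]].
  - by move=> [|x].
  - move=> i; rewrite size_map => lt_i; rewrite (nth_map symH) // /a wE nth_cat size_mat.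
    by rewrite ltnNge addSnnS leq_addr addKn.
  - by move=> j; apply: hindex_le.
  - exact: hindex_gt.
  - move=> s sZ sR; split=> //; rewrite sR.
    by rewrite (@has_vc_candidate _ _ a).
have [t [s [le_t reach [sZ sR]]]] :=
  @wp_sound _ _ main_prog (vRES, vZERO) Main _ _ [::] [::] (csize Main) wpM (esym (cats0 _)).
rewrite -size_main_prog in reach.
apply: (@decides_of_vm 20 4 main_prog (vRES, vZERO) main_prog_ok isT _ _ m_bnd mP _ _ _ _ reach).
  by apply: main_time => //; rewrite sz_w; nia.
(* The comparison also asks that the mark lie on the tape, which holds when the counter is 0. *)
rewrite /= sZ -sR andb_idr => [|/eqP-> //].
by split=> [/eqP|/eqP/negbTE].
Qed.
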